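(* Assume the correction factors are computed as in the context. Let $(Y^n,P^{n-1},U^n)$, $n=1,\dots,N_0$, be a solution of the fully-discrete AFC scheme (in the matrix form given in the context), with nodal coefficient vectors $\boldsymbol\alpha^n$ of $Y^n$ and $\boldsymbol\beta^{n}$ of $P^{n}$. Then, for all $k,h$, it satisfies the local discrete maximum principle, i.e., for every $n=1,\dots,N_0$ and every interior node index $i\in\mathcal N_h^0$, with $$\alpha_i^{\max}=\max\Big\{\max_{j\in\mathcal Z_h^i\cup\{i\}}\alpha_j^{n-1},\max_{j\in\mathcal Z_h^i}\alpha_j^n\Big\},\quad \alpha_i^{\min}=\min\Big\{\min_{j\in\mathcal Z_h^i\cup\{i\}}\alpha_j^{n-1},\min_{j\in\mathcal Z_h^i}\alpha_j^n\Big\},$$ $$\beta_i^{\max}=\max\Big\{\max_{j\in\mathcal Z_h^i\cup\{i\}}\beta_j^{n},\max_{j\in\mathcal Z_h^i}\beta_j^{n-1}\Big\},\quad \beta_i^{\min}=\min\Big\{\min_{j\in\mathcal Z_h^i\cup\{i\}}\beta_j^{n},\min_{j\in\mathcal Z_h^i}\beta_j^{n-1}\Big\},$$ the following hold. If $\sigma>0$: $G^n+BU^n\le0$ in $\omega_i$ implies $\alpha_i^n\le\max\{0,\alpha_i^{\max}\}$; $G^n+BU^n\ge0$ in $\omega_i$ implies $\alpha_i^n\ge\min\{0,\alpha_i^{\min}\}$; $Y^n-y_d^n\le0$ in $\omega_i$ implies $\beta_i^{n-1}\le\max\{0,\beta_i^{\max}\}$; $Y^n-y_d^n\ge0$ in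 $\omega_i$ implies $\beta_i^{n-1}\ge\min\{0,\beta_i^{\min}\}$. If $\sigma=0$: $G^n+BU^n\le0$ in $\omega_i$ implies $\alpha_i^n\le\alpha_i^{\max}$; $G^n+BU^n\ge0$ in $\omega_i$ implies $\alpha_i^n\ge\alpha_i^{\min}$; $Y^n-y_d^n\le0$ in $\omega_i$ implies $\beta_i^{n-1}\le\beta_i^{\max}$; $Y^n-y_d^n\ge0$ in $\omega_i$ implies $\beta_i^{n-1}\ge\beta_i^{\min}$.
   Context: **Data.** $\Omega\subset\mathbb R^2$ is a bounded convex polygonal domain, $T>0$; $(\cdot,\cdot)$ is the $L^2(\Omega)$ inner product. Given are constants $\mu>0$, $\sigma\ge0$, $\lambda>0$, $\mathsf{u_a}<\mathsf{u_b}$; a field $\mathbf b=\mathbf b(x,t)$ with $\mathbf b(\cdot,t)\in[W^1_\infty(\Omega)]^2$ and $\sigma-\frac12\operatorname{div}\mathbf b\ge\sigma_0>0$; functions $G,y_d$ with values in $L^2(\Omega)$; a bounded linear operator $B$ on $L^2(0,T;L^2)$ with adjoint $B^*$, also applied at fixed times to functions of $L^2(\Omega)$. $\Pi(v)=\max\{\mathsf{u_a},\min\{\mathsf{u_b},v\}\}$. **Discretization.** $\mathcal T_h$ belongs to a family of conforming triangulations of $\overline\Omega$, shape regular, quasi-uniform and with all triangle angles less than $\pi/2$; $h$ is the maximal diameter. Nodes $Z_i$, $i\in\mathcal N_h=\{1,\dots,N\}$; $\mathcal N_h^0$ = indices of interior nodes; $\mathcal Z_h^i$ = indices of nodes adjacent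 to $Z_i$; $\omega_i$ = union of triangles with vertex $Z_i$; $\phi_i$ = nodal hat functions. $S_h$ = continuous piecewise linear functions vanishing on $\partial\Omega$ (nodal coefficients at boundary nodes are zero). Matrices: $\mathbf M=(m_{ij})$, $m_{ij}=(\phi_i,\phi_j)$; $\mathbf M_L=\mathrm{diag}(m_i)$, $m_i=\sum_jm_{ij}$; $\mathbf S=(s_{ij})$, $s_{ij}=(\nabla\phi_i,\nabla\phi_j)$; $\mathbf T=(\tau_{ij})$, $\tau_{ij}=(\mathbf b\cdot\nabla\phi_j,\phi_i)$; $\mathbf D=(d_{ij})$, $d_{ij}=\min\{-\tau_{ij},0,-\tau_{ji}\}$ for $j\ne i$, $d_{ii}=-\sum_{j\ne i}d_{ij}$; $\widehat{\mathbf D}=(\widehat d_{ij})$, $\widehat d_{ij}=\max\{-\tau_{ij},0,-\tau_{ji}\}$ for $j\neq i$, $\widehat d_{ii}=-\sum_{j\ne i}\widehat d_{ij}$. For $s\in L^2$, $\mathbf r(s)=((s,\phi_i))_i$. Time-dependent coefficients are evaluated at the time level of the equation in question. **Correction factors.** For symmetric weights $c_{ij}\ge0$ ($i\neq j$) and vectors $\psi,\zeta\in\mathbb R^N$ let, for $i\in\mathcal N_h^0$, $P_i^+=\sum_{j\in\mathcal Z_h^i}\max\{0,c_{ij}(\psi_i-\psi_j)\}$, $P_i^-=\sum_{j\in\mathcal Z_h^i}\min\{0,c_{ij}(\psi_i-\psi_j)\}$, $Q_i^+=q_i(\zeta_i^{\max}-\zeta_i)$, $Q_i^-=q_i(\zeta_i^{\min}-\zeta_i)$,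 where (in this paragraph) $\zeta_i^{\max},\zeta_i^{\min}$ are the max/min of $\zeta$ over the nodes of $\omega_i$ (including $Z_i$), $q_i=\gamma_i\sum_{j\in\mathcal Z_h^i}c_{ij}$ and $\gamma_i=\max_{Z_j\in\partial\omega_i}|Z_i-Z_j|/\mathrm{dist}(Z_i,\partial\omega_i^{\rm conv})$ ($\omega_i^{\rm conv}$ the convex hull of $\omega_i$). $R_i^\pm=\min\{1,Q_i^\pm/P_i^\pm\}$ ($=1$ if $P_i^\pm=0$). $\overline a_{ij}=R_i^+$, $1$, $R_i^-$ according as $c_{ij}(\psi_i-\psi_j)$ is $>0$, $=0$, $<0$; for $i$ a boundary index $\overline a_{ij}=1$. Finally $a_{ij}^{c}(\psi,\zeta)=\min\{\overline a_{ij},\overline a_{ji}\}$. **Scheme in matrix form.** $N_0\ge1$, $k=T/N_0$, $t^n=nk$, $v^n=v(\cdot,t^n)$. $Y^0\in S_h$ is given, $P^{N_0}=0$. For $n=1,\dots,N_0$, in the rows $i\in\mathcal N_h^0$: $(\mathbf M_L+k(\mu\mathbf S+\mathbf T+\mathbf D+\sigma\mathbf M_L))\boldsymbol\alpha^n=\mathbf M_L\boldsymbol\alpha^{n-1}+k\,\mathbf r(BU^n+G^n)+k\,\overline{\mathsf f}+\overline{\mathsf g}$, $(\mathbf M_L+k(\mu\mathbf S-\mathbf T-\widehat{\mathbf D}+\sigma\mathbf M_L))\boldsymbol\beta^{n-1}=\mathbf M_L\boldsymbol\beta^{n}+k\mathbf M\boldsymbol\alpha^n-k\,\mathbf r(y_d^n)+k\,\overline{\widehat{\mathsf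 f}}+\overline{\widehat{\mathsf g}}$, and $U^n=\Pi(-\lambda^{-1}B^*P^{n-1})$, where $\overline{\mathsf f}_i=\sum_{j\ne i}a^{|d|}_{ij}(\boldsymbol\alpha^n,\boldsymbol\alpha^n)\,d_{ij}(\alpha_j^n-\alpha_i^n)$ (weights $c_{ij}=|d_{ij}|$), $\overline{\widehat{\mathsf f}}_i=\sum_{j\ne i}a^{\widehat d}_{ij}(\boldsymbol\beta^{n-1},\boldsymbol\beta^{n-1})\,\widehat d_{ij}(\beta_i^{n-1}-\beta_j^{n-1})$ (weights $\widehat d_{ij}$), $\overline{\mathsf g}_i=\sum_{j\ne i}a^{m}_{ij}(\boldsymbol\alpha^n-\boldsymbol\alpha^{n-1},\boldsymbol\alpha^n)\,m_{ij}\big((\alpha_i^n-\alpha_i^{n-1})-(\alpha_j^n-\alpha_j^{n-1})\big)$ (weights $m_{ij}$), $\overline{\widehat{\mathsf g}}_i=\sum_{j\ne i}a^{m}_{ij}(\boldsymbol\beta^{n-1}-\boldsymbol\beta^{n},\boldsymbol\beta^{n-1})\,m_{ij}\big((\beta_i^{n-1}-\beta_i^{n})-(\beta_j^{n-1}-\beta_j^{n})\big)$. *)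

(* Defs.v *)
From HB Require Import structures.
From mathcomp Require Import all_boot all_order all_algebra.
From mathcomp Require Import all_classical all_reals all_analysis.

Set Implicit Arguments.
Unset Strict Implicit.
Unset Printing Implicit Defensive.

Import Order.TTheory GRing.Theory Num.Theory.
Import numFieldNormedType.Exports.

Local Open Scope classical_set_scope.
Local Open Scope ring_scope.

Section Plane.
Context (R : realType).
Implicit Types (x y z : R * R) (A : set (R * R)).

Definition dot x y : R := x.1 * y.1 + x.2 * y.2.

(* The library norm `|x| on [R * R] is the sup norm. *)
Definition enorm x : R := Num.sqrt (dot x x).

Definition cross x y : R := x.1 * y.2 - x.2 * y.1.

(* Unoriented angle at [x] in the triangle [x], [y], [z]. *)
Definition angle x y z : R :=
  acos (dot (y - x) (z - x) / (enorm (y - x) * enorm (z - x))).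

Definition disc x (r : R) : set (R * R) := [set y | enorm (y - x) <= r].

Definition diam A : R := sup [set enorm (p.1 - p.2) | p in A `*` A].

Definition dist x A : R := inf [set enorm (x - y) | y in A].

Definition boundary A : set (R * R) := closure A `\` interior A.

Definition conv_hull A : set (R * R) :=
  smallest (fun C => convex_set (C : set (convex_lmodType (R * R)%type))) A.

Definition convex_polygonal_domain A : Prop :=
  [/\ open A, A !=set0, bounded_set A,
      convex_set (A : set (convex_lmodType (R * R)%type)) &
      exists V : seq (R * R), closure A = conv_hull [set` V]].

(* Convex hull of the points [z j], [j \in t]; the [w j] are barycentric
   coordinates.  It is empty when [t] is. *)
Definition simplex n (z : 'I_n -> R * R) (t : {set 'I_n}) : set (R * R) :=
  [set x | exists w : 'I_n -> R,
     [/\ forall j, 0 <= w j, forall j, j \notin t -> w j = 0,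
         \sum_j w j = 1 & x = \sum_j w j *: z j]].

End Plane.

(* A class in L^2(D) is represented by a function on the whole space, whose
   values outside [D] are irrelevant; identities between classes are a.e.
   identities on [D]. *)

Section L2.
Context d (X : measurableType d) (R : realType).
Variables (nu : {measure set X -> \bar R}) (D : set X).
Implicit Types (f g : X -> R) (A : (X -> R) -> (X -> R)).

Definition L2 f : Prop := f \_ D \in Lfun nu 2%:E.
Definition Linf f : Prop := f \_ D \in Lfun nu +oo%E.

Definition ip f g : R := \int[nu]_(x in D) (f x * g x).

Definition ae_on (P : X -> Prop) : Prop := {ae nu, forall x, D x -> P x}.

Definition L2eq f g : Prop := ae_on (fun x => f x = g x).

Definition L2norm f : \bar R := 'N[nu]_2%:E[EFin \o (f \_ D)].

Definition bounded_linear_L2 A : Prop :=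
  [/\ forall f, L2 f -> L2 (A f),
      forall (a : R) f g, L2 f -> L2 g ->
        L2eq (A (fun x => a * f x + g x)) (fun x => a * A f x + A g x) &
      exists C : R, forall f, L2 f -> (L2norm (A f) <= C%:E * L2norm f)%E].

Definition adjoint_L2 A A' : Prop :=
  [/\ bounded_linear_L2 A, bounded_linear_L2 A' &
      forall f g, L2 f -> L2 g -> ip (A f) g = ip f (A' g)].

End L2.

Definition leb2 (R : realType) :
    {measure set (measurableTypeR R * measurableTypeR R) -> \bar R} :=
  (@lebesgue_measure R \x @lebesgue_measure R)%E.

(* Space-time measure; points of space-time are pairs (x, t). *)
Definition leb3 (R : realType) :
    {measure set (measurableTypeR R * measurableTypeR R * measurableTypeR R)
       -> \bar R} :=
  (leb2 R \x @lebesgue_measure R)%E.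

Section SpaceTime.
Context (R : realType) (Omega : set (R * R)) (Tf : R).
Implicit Types (B : (R * R * R -> R) -> (R * R * R -> R))
  (Bt : R -> (R * R -> R) -> (R * R -> R)).

(* L^2(0,Tf; L^2(Omega)) is identified with L^2(cylinder). *)
Definition cylinder : set (R * R * R) := Omega `*` `]0, Tf[.

(* [Bt t] is the operator [B] applied at the fixed time [t]: (B w)(t) is
   [Bt t] applied to w(t). *)
Definition acts_at_fixed_times B Bt : Prop :=
  forall w, L2 (leb3 R) cylinder w ->
    {ae @lebesgue_measure R, forall t, 0 < t < Tf ->
      L2eq (leb2 R) Omega (fun x => B w (x, t)) (Bt t (fun x => w (x, t)))}.

End SpaceTime.

Section Sobolev.
Context (R : realType) (Omega : set (R * R)).
Implicit Types (f g phi : R * R -> R).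

Definition e1 : R * R := (1, 0).
Definition e2 : R * R := (0, 1).

Definition smooth phi : Prop :=
  forall s : seq (R * R),
    let psi : R * R -> R := foldr (fun v (h : R * R -> R) => 'D_v h) phi s in
    continuous psi /\ forall x v, derivable psi x v.

Definition test_function phi : Prop :=
  [/\ smooth phi, compact (closure [set x | phi x != 0]) &
      closure [set x | phi x != 0] `<=` Omega].

Definition weak_derivative (v : R * R) f g : Prop :=
  forall phi, test_function phi ->
    ip (leb2 R) Omega f ('D_v phi) = - ip (leb2 R) Omega g phi.

Definition W1inf f : Prop :=
  Linf (leb2 R) Omega f /\
  forall v, v = e1 \/ v = e2 ->
    exists2 g, Linf (leb2 R) Omega g & weak_derivative v f g.

Definition weak_divergence (u : R * R -> R * R) g : Prop :=
  exists g1 g2, [/\ weak_derivative e1 (fun x => (u x).1) g1,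
                    weak_derivative e2 (fun x => (u x).2) g2,
                    Linf (leb2 R) Omega g1, Linf (leb2 R) Omega g2 &
                    g = (fun x => g1 x + g2 x)].

(* The weak divergence [g] exists by the first two clauses and is unique up to
   a.e. equality, so that quantifying over it is quantifying over div u. *)
Definition admissible_field (sigma sigma0 : R) (u : R * R -> R * R) : Prop :=
  [/\ W1inf (fun x => (u x).1), W1inf (fun x => (u x).2) &
      forall g, weak_divergence u g ->
        ae_on (leb2 R) Omega (fun x => sigma0 <= sigma - g x / 2)].

End Sobolev.

Section Mesh.
Context (R : realType) (Omega : set (R * R)).

(* Conforming triangulation of the closure of [Omega]; an element is given by
   the set of (indices of) its three vertices. *)
Record triangulation := Triangulation {
  nnodes : nat;
  node : 'I_nnodes -> R * R;
  elements : {set {set 'I_nnodes}};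
  node_inj : injective node;
  node_vertex : forall i, exists2 t, t \in elements & i \in t;
  elements_nondegenerate : forall t, t \in elements ->
    exists i j l, t = [set i; j; l]%SET /\
      cross (node j - node i) (node l - node i) != 0;
  elements_cover :
    \bigcup_(t in [set` elements]) simplex node t = closure Omega;
  elements_conforming : forall t t', t \in elements -> t' \in elements ->
    simplex node t `&` simplex node t' = simplex node (t :&: t')%SET }.

Definition triangle (Th : triangulation) (t : {set 'I_(nnodes Th)}) :
  set (R * R) := simplex (@node Th) t.

Definition mesh_size (Th : triangulation) : R :=
  \big[Num.max/0]_(t in elements Th) diam (triangle t).

Implicit Types F : set triangulation.

(* Every triangle contains a disc of comparable size. *)
Definition shape_regular F : Prop :=
  exists2 kappa : R, 0 < kappa & forall Th, F Th ->
    forall t, t \in elements Th -> exists x r,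
      [/\ 0 < r, disc x r `<=` triangle t & diam (triangle t) <= kappa * r].

Definition quasi_uniform F : Prop :=
  exists2 c : R, 0 < c & forall Th, F Th ->
    forall t, t \in elements Th -> c * mesh_size Th <= diam (triangle t).

Definition acute F : Prop :=
  forall Th, F Th -> forall t, t \in elements Th ->
    forall i j l, t = [set i; j; l]%SET ->
      angle (node i) (node j) (node l) < pi / 2.

Section OneMesh.
Variable Th : triangulation.
Local Notation N := (nnodes Th).
Implicit Types (i j : 'I_N) (phi : 'I_N -> R * R -> R).

Definition interior_node i : bool := `[< Omega (node i) >].

(* Indices of the nodes adjacent to node [i], excluding [i] itself. *)
Definition nbrs i : {set 'I_N} :=
  [set j | (j != i) && [exists t in elements Th, (i \in t) && (j \in t)]]%SET.

Definition patch_of i : set (R * R) :=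
  \bigcup_(t in [set t | (t \in elements Th) && (i \in t)]) triangle t.

(* Nodal hat functions; these conditions determine [phi i] on closure Omega. *)
Definition nodal_basis phi : Prop :=
  forall i,
    [/\ {within closure Omega, continuous (phi i)},
        forall t, t \in elements Th -> exists (a : R) (v : R * R),
          forall x, triangle t x -> phi i x = a + dot v x &
        forall j, phi i (node j) = (i == j)%:R].

Definition fe_fun phi (a : 'cV[R]_N) : R * R -> R :=
  fun x => \sum_j a j 0 * phi j x.

(* Coefficient vectors of elements of S_h. *)
Definition in_Sh (a : 'cV[R]_N) : Prop :=
  forall i, ~~ interior_node i -> a i 0 = 0.

(* Gradient of a piecewise linear function: the classical gradient inside the
   triangles, set to 0 on the null set of edges, where it does not exist. *)
Definition grad (f : R * R -> R) (x : R * R) : R * R :=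
  if `[< exists2 t, t \in elements Th & interior (triangle t) x >]
  then ('D_(e1 R) f x, 'D_(e2 R) f x) else 0.

Definition massM phi : 'M[R]_N :=
  \matrix_(i, j) ip (leb2 R) Omega (phi i) (phi j).

Definition lumpedM phi : 'M[R]_N :=
  diag_mx (\row_i \sum_j massM phi i j).

Definition stiffM phi : 'M[R]_N :=
  \matrix_(i, j) \int[leb2 R]_(x in Omega)
    dot (grad (phi i) x) (grad (phi j) x).

Definition convM (u : R * R -> R * R) phi : 'M[R]_N :=
  \matrix_(i, j)
    ip (leb2 R) Omega (fun x => dot (u x) (grad (phi j) x)) (phi i).

(* The diagonal is the one making the row sums vanish; [c i i] is ignored. *)
Definition zero_rowsum (c : 'I_N -> 'I_N -> R) : 'M[R]_N :=
  \matrix_(i, j) if i == j then - \sum_(l | l != i) c i l else c i j.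

Definition diffM (tau : 'M[R]_N) : 'M[R]_N :=
  zero_rowsum
    (fun i j => Num.min (Num.min (- tau i j) 0) (- tau j i)).

Definition diffhatM (tau : 'M[R]_N) : 'M[R]_N :=
  zero_rowsum
    (fun i j => Num.max (Num.max (- tau i j) 0) (- tau j i)).

Definition loadV (s : R * R -> R) phi : 'cV[R]_N :=
  \col_i ip (leb2 R) Omega s (phi i).

Section Limiter.
Variables (c : 'M[R]_N) (psi zeta : 'cV[R]_N).

Definition flux i j : R := c i j * (psi i 0 - psi j 0).

Definition Pplus i : R := \sum_(j in nbrs i) Num.max 0 (flux i j).
Definition Pminus i : R := \sum_(j in nbrs i) Num.min 0 (flux i j).

Definition gamma i : R :=
  \big[Num.max/0]_(j : 'I_N | `[< boundary (patch_of i) (node j) >])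
      enorm (node i - node j)
  / dist (node i) (boundary (conv_hull (patch_of i))).

Definition qcoef i : R := gamma i * \sum_(j in nbrs i) c i j.

(* The nodes of the patch of an interior node [i] are [i] and its neighbours. *)
Definition patch_max i : R := \big[Num.max/zeta i 0]_(j in nbrs i) zeta j 0.
Definition patch_min i : R := \big[Num.min/zeta i 0]_(j in nbrs i) zeta j 0.

Definition Qplus i : R := qcoef i * (patch_max i - zeta i 0).
Definition Qminus i : R := qcoef i * (patch_min i - zeta i 0).

Definition Rplus i : R :=
  if Pplus i == 0 then 1 else Num.min 1 (Qplus i / Pplus i).
Definition Rminus i : R :=
  if Pminus i == 0 then 1 else Num.min 1 (Qminus i / Pminus i).

Definition abar i j : R :=
  if interior_node i then
    if 0 < flux i j then Rplus i
    else if flux i j == 0 then 1 else Rminus i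
  else 1.

Definition afactor i j : R := Num.min (abar i j) (abar j i).

End Limiter.

Definition fbar (D : 'M[R]_N) (a : 'cV[R]_N) : 'cV[R]_N :=
  \col_i \sum_(j | j != i)
    afactor (map_mx Num.norm D) a a i j * D i j * (a j 0 - a i 0).

Definition fhatbar (Dh : 'M[R]_N) (p : 'cV[R]_N) : 'cV[R]_N :=
  \col_i \sum_(j | j != i)
    afactor Dh p p i j * Dh i j * (p i 0 - p j 0).

Definition gbar (M : 'M[R]_N) (new old : 'cV[R]_N) : 'cV[R]_N :=
  \col_i \sum_(j | j != i)
    afactor M (new - old) new i j * M i j *
    ((new i 0 - old i 0) - (new j 0 - old j 0)).

Definition state_row (mu sigma k : R) (u : R * R -> R * R) phi
    (s : R * R -> R) (anew aold : 'cV[R]_N) i : Prop :=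
  let ML := lumpedM phi in let tau := convM u phi in
  ((ML + k *: (mu *: stiffM phi + tau + diffM tau + sigma *: ML)) *m anew) i 0
  = (ML *m aold) i 0 + k * loadV s phi i 0
    + k * fbar (diffM tau) anew i 0 + gbar (massM phi) anew aold i 0.

Definition adjoint_row (mu sigma k : R) (u : R * R -> R * R) phi
    (yd : R * R -> R) (a pnew pold : 'cV[R]_N) i : Prop :=
  let ML := lumpedM phi in let tau := convM u phi in
  ((ML + k *: (mu *: stiffM phi - tau - diffhatM tau + sigma *: ML))
     *m pnew) i 0
  = (ML *m pold) i 0 + k * (massM phi *m a) i 0 - k * loadV yd phi i 0
    + k * fhatbar (diffhatM tau) pnew i 0 + gbar (massM phi) pnew pold i 0.

(* The inner maximum serves as the default value of the outer one, so this is
   the maximum of [old] over nbrs i and i, and of [new] over nbrs i. *)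
Definition loc_max (new old : 'cV[R]_N) i : R :=
  \big[Num.max/ \big[Num.max/old i 0]_(j in nbrs i) old j 0]_(j in nbrs i)
    new j 0.

Definition loc_min (new old : 'cV[R]_N) i : R :=
  \big[Num.min/ \big[Num.min/old i 0]_(j in nbrs i) old j 0]_(j in nbrs i)
    new j 0.

(* Functions of L^2(Omega) carry no values off [Omega]; for an interior node
   the patch exceeds [Omega] by a null set at most. *)
Definition ae_patch i (P : R * R -> Prop) : Prop :=
  ae_on (leb2 R) (patch_of i `&` Omega) P.

End OneMesh.
End Mesh.

Definition box_proj (R : realType) (ua ub v : R) : R :=
  Num.max ua (Num.min ub v).

(* [alpha n], [beta n], [U n] stand for Y^n, P^n, U^n; [b t], [G t], [yd t],
   [Bt t], [Bst t] are evaluations at time [t]; [sadj n] is the time at which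
   the convection field of the [n]-th adjoint equation is evaluated. *)
Definition afc_solution (R : realType) (Omega : set (R * R))
    (Th : triangulation Omega) (phi : 'I_(nnodes Th) -> R * R -> R)
    (mu sigma lambda ua ub k : R) (N0 : nat)
    (b : R -> R * R -> R * R) (G yd : R -> R * R -> R)
    (Bt Bst : R -> (R * R -> R) -> (R * R -> R)) (sadj : nat -> R)
    (alpha beta : nat -> 'cV[R]_(nnodes Th)) (U : nat -> R * R -> R) : Prop :=
  [/\ (forall n, (n <= N0)%N -> in_Sh (alpha n) /\ in_Sh (beta n)),
      beta N0 = 0 &
      forall n, (1 <= n <= N0)%N ->
        let tn := n%:R * k in
        [/\ forall i, interior_node i ->
              state_row mu sigma k (b tn) phi
                (fun x => Bt tn (U n) x + G tn x) (alpha n) (alpha n.-1) i,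
            forall i, interior_node i ->
              adjoint_row mu sigma k (b (sadj n)) phi
                (yd tn) (alpha n) (beta n.-1) (beta n) i,
            L2 (leb2 R) Omega (U n) &
            L2eq (leb2 R) Omega (U n) (fun x => box_proj ua ub
              (- lambda^-1 * Bst tn (fe_fun phi (beta n.-1)) x))]].

(* Main.v *)
(* Suppose that the unknown x of a row exceeds, at an interior node i, all its
   neighbours and the old value y_i.  Then Q_i^+ = 0, so every antidiffusive
   flux out of i is suppressed: the upwind part is fully active, and its
   off-diagonal entries tau + d are nonpositive; the mass correction can only
   help, because its surviving terms have the sign of the lumped increment.
   Acuteness makes the off-diagonal stiffness entries nonpositive, and the row
   sums of all the matrices but the lumped mass vanish.  What remains is
   m_i (x_i - y_i) + (nonnegative terms) <= k * load, so a nonpositive load is a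
   contradiction.  The scheme is odd in the unknowns and the load, which gives
   the minima. *)
Require Import Defs.
From HB Require Import structures.
From mathcomp Require Import all_boot all_order all_algebra.
From mathcomp Require Import all_classical all_reals all_analysis.
From mathcomp Require Import measurable_realfun ess_sup_inf.
From mathcomp Require Import ring lra.

Set Implicit Arguments.
Unset Strict Implicit.

Import Order.TTheory GRing.Theory Num.Theory.
Import numFieldNormedType.Exports.

Local Open Scope classical_set_scope.
Local Open Scope ring_scope.

(** * Euclidean geometry of the plane and derivatives of affine functions *)

Section PlaneGeometry.
Context {R : realType}.
Implicit Types (u v x y z p q : R * R).

Lemma enorm_ge0 v : 0 <= enorm v.
Proof. exact: sqrtr_ge0. Qed.

Lemma dotDr v x y : dot v (x + y) = dot v x + dot v y.
Proof. by rewrite /dot /=; ring. Qed.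

Lemma dotZr v (a : R) x : dot v (a *: x) = a * dot v x.
Proof. by rewrite /dot /= /GRing.scale /=; ring. Qed.

Lemma dotBr v x y : dot v (x - y) = dot v x - dot v y.
Proof. by rewrite /dot /=; ring. Qed.

Lemma dot0r v : dot v 0 = 0.
Proof. by rewrite /dot /= !mulr0 addr0. Qed.

Lemma dotC u v : dot u v = dot v u.
Proof. by rewrite /dot; ring. Qed.

Lemma dot_sumr (I : Type) (r : seq I) (P : pred I) v (F : I -> R * R) :
  dot v (\sum_(j <- r | P j) F j) = \sum_(j <- r | P j) dot v (F j).
Proof. by apply: (big_morph (dot v)); [exact: dotDr|exact: dot0r]. Qed.

Lemma dot_suml (I : Type) (r : seq I) (P : pred I) v (F : I -> R * R) :
  dot (\sum_(j <- r | P j) F j) v = \sum_(j <- r | P j) dot (F j) v.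
Proof. by rewrite dotC dot_sumr; apply: eq_bigr => j _; rewrite dotC. Qed.

(** By Lagrange's identity the squares of the two sides differ by [cross x y ^+ 2]. *)
Lemma dot_le_enorm x y : `|dot x y| <= enorm x * enorm y.
Proof.
rewrite /enorm -sqrtrM; last by rewrite addr_ge0 // -expr2 sqr_ge0.
rewrite -sqrtr_sqr ler_sqrt; last first.
  by rewrite mulr_ge0 // addr_ge0 // -expr2 sqr_ge0.
rewrite -subr_ge0 (_ : _ - _ = (cross x y) ^+ 2) ?sqr_ge0 //.
by rewrite /dot /cross; ring.
Qed.

(** If the dot product were nonpositive, so would be the quotient inside [acos], which is the cosine
    of the angle; but the cosine is positive on [0, pi/2). The Cauchy-Schwarz inequality puts the
    quotient in the range where [acosK] applies. *)
Lemma acute_dot_gt0 x y z : angle x y z < pi / 2 -> 0 < dot (y - x) (z - x).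
Proof.
rewrite /angle; set d := dot _ _; set e := enorm _ * _.
have e0 : 0 <= e by exact: mulr_ge0 (enorm_ge0 _) (enorm_ge0 _).
have de : `|d| <= e := dot_le_enorm _ _.
move=> h; rewrite ltNge; apply/negP => d0.
have c0 : d / e <= 0 by rewrite mulr_le0_ge0 // invr_ge0.
have c1 : -1 <= d / e.
  (* When a side has length 0 the quotient is 0, by the convention [0^-1 = 0]. *)
  have [->|e_neq0] := eqVneq e 0; first by rewrite invr0 mulr0 lerN10.
  rewrite ler_pdivlMr ?lt_neqAle 1?eq_sym ?e_neq0 // mulN1r.
  by move: de; rewrite ler_norml => /andP[].
have c11 : -1 <= d / e <= 1 by rewrite c1 (le_trans c0).
have := @cos_gt0_pihalf R (acos (d / e)); rewrite acosK; last by rewrite in_itv.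
rewrite h andbT (lt_le_trans _ (acos_ge0 c11)); last first.
  by rewrite oppr_lt0 divr_gt0 // pi_gt0.
by move=> /(_ isT); rewrite ltNge c0.
Qed.

(* [u], [v] is the dual basis of [p], [q], so its Gram matrix is the inverse of
   the Gram matrix of [p], [q], whose determinant is [cross p q ^+ 2]. *)
Lemma dual_basis_dot_lt0 u v p q : dot u p = 1 -> dot u q = 0 ->
  dot v p = 0 -> dot v q = 1 -> 0 < dot p q -> dot u v < 0.
Proof.
(* Cramer's rule for each coordinate, without dividing by [d]: a factor 1 is replaced by the dot
   product equal to 1, and a multiple of the one equal to 0 is added. *)
rewrite /dot => up uq vp vq pq; set d := cross p q.
have u1 : u.1 * d = q.2.
  by rewrite /d /cross -[RHS]mul1r -up -[LHS]addr0 -(mulr0 p.2) -uq; ring.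
have u2 : u.2 * d = - q.1.
  by rewrite /d /cross -[q.1 in RHS]mul1r -up -[LHS]addr0 -(mulr0 (- p.1)) -uq; ring.
have v1 : v.1 * d = - p.2.
  by rewrite /d /cross -[p.2 in RHS]mul1r -vq -[LHS]addr0 -(mulr0 (- q.2)) -vp; ring.
have v2 : v.2 * d = p.1.
  by rewrite /d /cross -[p.1 in RHS]mul1r -vq -[LHS]addr0 -(mulr0 q.1) -vp; ring.
have : (u.1 * v.1 + u.2 * v.2) * (d * d) < 0.
  rewrite (_ : _ * _ = (u.1 * d) * (v.1 * d) + (u.2 * d) * (v.2 * d)); last by ring.
  by rewrite u1 u2 v1 v2; move: pq; lra.
apply: contraTT; rewrite -!leNgt => h; apply: mulr_ge0 => //.
by rewrite -expr2 sqr_ge0.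
Qed.

Lemma derive_affine (f : R * R -> R) (a : R) v x (e : R * R) :
  (\forall y \near x, f y = a + dot v y) -> 'D_e f x = dot v e.
Proof.
move=> fa; rewrite (near_eq_derive _ fa) /derive.
(* The difference quotient of an affine function equals [dot v e] for every [h != 0]. *)
apply: cvg_lim => //; apply: cvg_near_cst.
near=> h => /=.
rewrite dotDr dotZr /GRing.scale /=.
have h0 : h != 0 by near: h; exact: nbhs_dnbhs_neq.
by field.
Unshelve. all: by end_near. Qed.

End PlaneGeometry.

(** * Nodal hat functions and their gradients *)

Section Hat.
Context {R : realType} {Omega : set (R * R)} {Th : triangulation Omega}.
Local Notation N := (nnodes Th).
Variable phi : 'I_N -> R * R -> R.
Hypothesis hphi : nodal_basis phi.
Implicit Types (i j : 'I_N) (t : {set 'I_N}) (x : R * R) (f : R * R -> R).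

Lemma triangle_node t j : j \in t -> triangle t (node j).
Proof.
move=> jt; exists (fun l => (l == j)%:R); split=> [l|l lt||].
- exact: ler0n.
- by case: eqP lt => // ->; rewrite jt.
- by rewrite (bigD1 j) //= eqxx big1 ?addr0 // => l /negPf->.
- rewrite (bigD1 j) //= eqxx scale1r big1 ?addr0 // => l /negPf->.
  by rewrite scale0r.
Qed.

(** On an element a hat function is affine, so it commutes with convex combinations of the vertices,
    and the nodal values select one barycentric coordinate. The sign, the partition of unity and the
    support of the hats are read off from this. *)
Lemma hat_simplex t (w : 'I_N -> R) i : t \in elements Th ->
  (forall j, 0 <= w j) -> (forall j, j \notin t -> w j = 0) ->
  \sum_j w j = 1 -> phi i (\sum_j w j *: node j) = w i.
Proof.
move=> tT w0 wt w1; have [_ aff nod] := hphi i.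
have [a [v av]] := aff t tT.
rewrite av; last by exists w.
rewrite dot_sumr.
transitivity (\sum_j w j * phi i (node j)).
  (* The constant [a] is distributed over the weights, whose sum is 1. Nodes outside [t], where the
     affine formula may fail, carry weight 0. *)
  rewrite -[a]mul1r -w1 mulr_suml -big_split /=; apply: eq_bigr => j _.
  have [jt|/wt->] := boolP (j \in t); last by rewrite dotZr !mul0r addr0.
  by rewrite (av _ (triangle_node jt)) dotZr -mulrDr.
under eq_bigr do rewrite nod.
rewrite (bigD1 i) //= eqxx mulr1 big1 ?addr0 // => j.
by rewrite eq_sym => /negPf->; rewrite mulr0.
Qed.

Lemma closure_triangle x : closure Omega x ->
  exists2 t, t \in elements Th & triangle t x.
Proof. by rewrite -(elements_cover Th) => -[t /= tT tx]; exists t. Qed.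

Lemma triangle_closure t x : t \in elements Th -> triangle t x -> closure Omega x.
Proof. by move=> tT tx; rewrite -(elements_cover Th); exists t. Qed.

Lemma hat_out t i x : t \in elements Th -> i \notin t -> triangle t x ->
  phi i x = 0.
Proof. by move=> tT it [w [w0 wt w1 ->]]; rewrite (hat_simplex (t := t)) // wt. Qed.

Lemma hat_sum1 x : closure Omega x -> \sum_j phi j x = 1.
Proof.
case/closure_triangle => t tT [w [w0 wt w1 ->]]; rewrite -[RHS]w1.
by apply: eq_bigr => j _; rewrite (hat_simplex (t := t)).
Qed.

Lemma hat_ge0 i x : closure Omega x -> 0 <= phi i x.
Proof.
by case/closure_triangle => t tT [w [w0 wt w1 ->]]; rewrite (hat_simplex (t := t)).
Qed.

Lemma hat_le1 i x : closure Omega x -> phi i x <= 1.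
Proof.
move=> hx; rewrite -(hat_sum1 hx) (bigD1 i) //= lerDl.
by apply: sumr_ge0 => j _; exact: hat_ge0.
Qed.

Lemma hat_nbrs i j x : closure Omega x -> j != i -> j \notin nbrs i ->
  phi i x * phi j x = 0.
Proof.
case/closure_triangle => t tT tx ji; rewrite !inE ji /=.
have [it|/hat_out->//] := boolP (i \in t); last by rewrite mul0r.
have [jt|/hat_out->//] := boolP (j \in t); last by rewrite mulr0.
by case/existsP; exists t; rewrite tT it jt.
Qed.

Lemma hat_off_patch i x : closure Omega x -> ~ patch_of i x -> phi i x = 0.
Proof.
case/closure_triangle => t tT tx hp; apply: (hat_out tT) => //.
by apply/negP => it; apply: hp; exists t => //=; rewrite tT.
Qed.

Lemma grad_affine f t (a : R) (v : R * R) x : t \in elements Th ->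
  interior (triangle t) x -> (forall y, triangle t y -> f y = a + dot v y) ->
  grad Th f x = v.
Proof.
move=> tT tx fa; rewrite /grad asboolT; last by exists t.
have fn : \forall y \near x, f y = a + dot v y by apply: filterS tx.
rewrite !(derive_affine _ fn) /dot /=.
by rewrite !mulr0 !mulr1 addr0 add0r; case: (v).
Qed.

Lemma grad_off f x : (forall t, t \in elements Th -> ~ interior (triangle t) x) ->
  grad Th f x = 0.
Proof. by move=> h; rewrite /grad asboolF // => -[t /h]. Qed.

(** Since [grad] is 0 off the open triangles, identities between gradients hold at every point and
    need a proof only inside one element. *)
Lemma in_interior_triangle x :
  (exists2 t, t \in elements Th & interior (triangle t) x) \/
  (forall f, grad Th f x = 0).
Proof.
have [h|h] := pselect (exists2 t, t \in elements Th & interior (triangle t) x).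
  by left.
by right=> f; apply: grad_off => t tT tx; apply: h; exists t.
Qed.

Lemma grad_hat_out t i x : t \in elements Th -> i \notin t ->
  interior (triangle t) x -> grad Th (phi i) x = 0.
Proof.
move=> tT it tx; apply: (@grad_affine _ t 0 0) => // y ty.
by rewrite dotC dot0r addr0 (hat_out tT).
Qed.

(** The hats sum to the constant 1. This makes the row sums of the stiffness and convection matrices
    vanish. *)
Lemma grad_hat_sum x : \sum_j grad Th (phi j) x = 0.
Proof.
have [[t tT tx]|h] := in_interior_triangle x; last first.
  by apply: big1 => j _.
(* The affine data of all hats on [t] are chosen at once, so that they can be summed. *)
have [av hav] : {av : 'I_N -> R * (R * R) & forall j y, triangle t y ->
    phi j y = (av j).1 + dot (av j).2 y}.
  apply: (@choice _ _ (fun j (av : R * (R * R)) => forall y, triangle t y ->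
    phi j y = av.1 + dot av.2 y)) => j.
  by have [_ /(_ t tT)[a [v h]] _] := hphi j; exists (a, v).
transitivity (grad Th (fun y => \sum_j phi j y) x); last first.
  apply: (@grad_affine _ t 1 0) => // y ty.
  by rewrite dotC dot0r addr0 hat_sum1 //; exact: triangle_closure ty.
rewrite (@grad_affine _ t (\sum_j (av j).1) (\sum_j (av j).2)) // => [|y ty].
  by apply: eq_bigr => j _; apply: (grad_affine tT tx) => y /hav; exact.
by rewrite dot_suml -big_split /=; apply: eq_bigr => j _; exact: hav.
Qed.

Lemma grad_hat_nbrs i j x : j != i -> j \notin nbrs i ->
  dot (grad Th (phi i) x) (grad Th (phi j) x) = 0.
Proof.
move=> ji; rewrite !inE ji /= => hn.
have [[t tT tx]|->] := in_interior_triangle x; last by rewrite dotC dot0r.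
have [it|it] := boolP (i \in t); last by rewrite (grad_hat_out tT it) // dotC dot0r.
have [jt|jt] := boolP (j \in t); last by rewrite (grad_hat_out tT jt) // dot0r.
by case/existsP: hn; exists t; rewrite tT it jt.
Qed.

Lemma hat_grad_nbrs i j x : j != i -> j \notin nbrs i ->
  grad Th (phi j) x = 0 \/ phi i x = 0.
Proof.
move=> ji; rewrite !inE ji /= => hn.
have [[t tT tx]|->] := in_interior_triangle x; last by left.
have [it|it] := boolP (i \in t); last first.
  by right; apply: (hat_out tT) => //; exact: interior_subset.
have [jt|jt] := boolP (j \in t); last by left; apply: (grad_hat_out tT).
by case/existsP: hn; exists t; rewrite tT it jt.
Qed.

(** The gradient product for an edge depends on the opposite angle. The remaining vertex is
    therefore listed first, the place where [acute] measures the angle. *)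
Lemma third_vertex t i j : t \in elements Th -> i \in t -> j \in t -> j != i ->
  exists l, [/\ t = [set l; i; j]%SET, l != i & l != j].
Proof.
move=> tT it jt ji; have [a [b [c [tE abc]]]] := elements_nondegenerate tT.
have ab : a != b by apply: contraNneq abc => ->; rewrite subrr /cross /= !mul0r subrr.
have ac : a != c by apply: contraNneq abc => ->; rewrite subrr /cross /= !mulr0 subrr.
have bc : b != c.
  by apply: contraNneq abc => ->; rewrite /cross mulrC subrr.
have it' : [|| i == a, i == b | i == c] by move: it; rewrite tE !inE orbA.
have jt' : [|| j == a, j == b | j == c] by move: jt; rewrite tE !inE orbA.
have perm l m n : [set l; m; n]%SET = [set a; b; c]%SET ->
    t = [set l; m; n]%SET by rewrite tE.
case/or3P: it' => /eqP ei; case/or3P: jt' => /eqP ej; subst i j;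
  rewrite ?eqxx // in ji;
  [exists c|exists b|exists c|exists a|exists b|exists a];
  split; rewrite // 1?eq_sym //; apply: perm; apply/setP => l; rewrite !inE;
  by do 3 case: (l == _).
Qed.

End Hat.

(** With the third vertex [l] as origin, the two gradients form the dual basis of the edges from [l]
    to [i] and [j]. The angle at [l] is acute, so these edges have a positive dot product and the
    gradients a negative one. *)
Lemma grad_hat_acute {R : realType} {Omega : set (R * R)}
    (F : set (triangulation Omega)) (Th : triangulation Omega)
    (phi : 'I_(nnodes Th) -> R * R -> R) i j x :
  acute F -> F Th -> nodal_basis phi -> j != i ->
  dot (grad Th (phi i) x) (grad Th (phi j) x) <= 0.
Proof.
move=> hac hF hphi ji.
have [[t tT tx]|->] := in_interior_triangle (Th := Th) x; last by rewrite dotC dot0r.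
have [it|it] := boolP (i \in t); last first.
  by rewrite (grad_hat_out hphi tT it) // dotC dot0r.
have [jt|jt] := boolP (j \in t); last first.
  by rewrite (grad_hat_out hphi tT jt) // dot0r.
have [l [tE li lj]] := third_vertex tT it jt ji.
have lt : l \in t by rewrite tE !inE eqxx.
have [_ /(_ t tT)[a [u hu]] ni] := hphi i.
have [_ /(_ t tT)[b [v hv]] nj] := hphi j.
rewrite (grad_affine tT tx hu) (grad_affine tT tx hv).
have gi m : m \in t -> a + dot u (node m) = (i == m)%:R.
  by move=> mt; rewrite -hu ?ni //; exact: triangle_node.
have gj m : m \in t -> b + dot v (node m) = (j == m)%:R.
  by move=> mt; rewrite -hv ?nj //; exact: triangle_node.
have := gi _ it; have := gi _ jt; have := gi _ lt.
have := gj _ it; have := gj _ jt; have := gj _ lt.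
rewrite !eqxx (eq_sym i j) (negPf ji) (eq_sym i l) (eq_sym j l).
rewrite (negPf li) (negPf lj) /= => vl vj vi ul uj ui.
apply/ltW/(@dual_basis_dot_lt0 _ u v (node i - node l) (node j - node l)).
- by rewrite dotBr; lra.
- by rewrite dotBr; lra.
- by rewrite dotBr; lra.
- by rewrite dotBr; lra.
- exact/acute_dot_gt0/(hac _ hF t tT).
Qed.

(** * Sign, symmetry and vanishing of the correction factors *)

Section Limiter.
Context {R : realType} {Omega : set (R * R)} {Th : triangulation Omega}.
Local Notation N := (nnodes Th).
Implicit Types (c : 'M[R]_N) (psi zeta x y : 'cV[R]_N) (i j : 'I_N).

Lemma gamma_ge0 i : 0 <= @gamma _ _ Th i.
Proof.
rewrite /gamma divr_ge0 //.
  by elim/big_ind: _ => // [a b a0 b0|j _]; rewrite ?le_max ?a0 ?enorm_ge0.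
rewrite /dist; set A := [set _ | _ in _].
(* The infimum of the empty set is 0 by convention. *)
have [A0|/set0P/negP/negPn/eqP->] := pselect (A !=set0); last by rewrite inf0.
by apply: lb_le_inf => // _ [y _ <-]; exact: enorm_ge0.
Qed.

Lemma nbrs_neq i j : j \in nbrs i -> j != i.
Proof. by rewrite !inE => /andP[]. Qed.

Lemma qcoef_ge0 c i : (forall j, j != i -> 0 <= c i j) -> 0 <= qcoef c i.
Proof.
by move=> c0; rewrite mulr_ge0 ?gamma_ge0 ?sumr_ge0 // => j /nbrs_neq /c0.
Qed.

Lemma patch_max_ge zeta i : zeta i 0 <= patch_max zeta i.
Proof. exact: bigmax_ge_id. Qed.

Lemma Pplus_ge0 c psi i : 0 <= Pplus c psi i.
Proof. by apply: sumr_ge0 => j _; rewrite le_max lexx. Qed.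

Lemma Rplus_itv c psi zeta i : (forall j, j != i -> 0 <= c i j) ->
  0 <= Rplus c psi zeta i <= 1.
Proof.
move=> c0; rewrite /Rplus; case: ifP => _; first by rewrite ler01 lexx.
rewrite ge_min lexx le_min ler01 /= andbT divr_ge0 ?Pplus_ge0 //.
by rewrite mulr_ge0 ?qcoef_ge0 // subr_ge0 patch_max_ge.
Qed.

Lemma fluxN c psi i j : flux c (- psi) i j = - flux c psi i j.
Proof. by rewrite /flux !mxE; ring. Qed.

Lemma PplusN c psi i : Pplus c (- psi) i = - Pminus c psi i.
Proof.
rewrite /Pplus /Pminus -sumrN; apply: eq_bigr => j _.
by rewrite fluxN -{1}oppr0 oppr_min.
Qed.

Lemma patch_maxN zeta i : patch_max (- zeta) i = - patch_min zeta i.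
Proof.
rewrite /patch_max /patch_min mxE; elim/big_rec2: _ => // j a b _ ->.
by rewrite mxE oppr_min.
Qed.

Lemma RplusN c psi zeta i : Rplus c (- psi) (- zeta) i = Rminus c psi zeta i.
Proof.
rewrite /Rplus /Rminus PplusN oppr_eq0; case: ifP => // _.
rewrite /Qplus /Qminus patch_maxN mxE opprK; congr (Num.min 1 _).
by rewrite invrN mulrN -mulNr -mulrN opprD opprK.
Qed.

Lemma RminusN c psi zeta i : Rminus c (- psi) (- zeta) i = Rplus c psi zeta i.
Proof. by rewrite -RplusN !opprK. Qed.

Lemma Rminus_itv c psi zeta i : (forall j, j != i -> 0 <= c i j) ->
  0 <= Rminus c psi zeta i <= 1.
Proof. by rewrite -RplusN; exact: Rplus_itv. Qed.

(** Negation reverses the flux and exchanges [Rplus] with [Rminus], so the branches of [abar] are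
    swapped with their values preserved. *)
Lemma afactorN c psi zeta i j :
  afactor c (- psi) (- zeta) i j = afactor c psi zeta i j.
Proof.
have abarN a b : abar c (- psi) (- zeta) a b = abar c psi zeta a b.
  rewrite /abar fluxN RplusN RminusN oppr_gt0 oppr_eq0; case: ifP => // _.
  by case: ltgtP.
by rewrite /afactor !abarN.
Qed.

Lemma afactor_itv c psi zeta i j : (forall a b, b != a -> 0 <= c a b) ->
  0 <= afactor c psi zeta i j <= 1.
Proof.
move=> c0; have abar_itv a b : 0 <= abar c psi zeta a b <= 1.
  rewrite /abar; case: ifP => _; last by rewrite ler01 lexx.
  have := Rplus_itv psi zeta (c0 a); have := Rminus_itv psi zeta (c0 a).
  by do 2 case: ifP => // _; rewrite ler01 lexx.
have /andP[a0 a1] := abar_itv i j; have /andP[b0 _] := abar_itv j i.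
by rewrite /afactor le_min ge_min a0 a1 b0.
Qed.

(* At a local maximum of [zeta] the bound [Q+] vanishes, hence so does [R+]. *)
Lemma afactor_local_max c psi zeta i j : (forall a b, b != a -> 0 <= c a b) ->
  interior_node i -> (forall l, l \in nbrs i -> zeta l 0 <= zeta i 0) ->
  j \in nbrs i -> 0 < flux c psi i j -> afactor c psi zeta i j = 0.
Proof.
move=> c0 hi hmax hj hf; apply/eqP; rewrite eq_le.
have /andP[-> _] := afactor_itv psi zeta i j c0; rewrite andbT.
rewrite /afactor ge_min; apply/orP; left.
rewrite /abar hi hf /Rplus.
have -> : Qplus c zeta i = 0.
  rewrite /Qplus; have -> : patch_max zeta i = zeta i 0; last by rewrite subrr mulr0.
  apply/eqP; rewrite eq_le patch_max_ge andbT /patch_max.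
  exact/bigmax_leP.
have P0 : 0 < Pplus c psi i.
  rewrite /Pplus (bigD1 j) //= ltr_wpDr ?lt_max ?hf ?orbT //.
  by apply: sumr_ge0 => l _; rewrite le_max lexx.
by rewrite gt_eqF // mul0r ge_min lexx orbT.
Qed.

Lemma loc_max_ge x y i :
  [/\ forall j, j \in nbrs i -> x j 0 <= loc_max x y i & y i 0 <= loc_max x y i].
Proof.
split; first by move=> j jn; rewrite /loc_max (bigmaxD1 j) //= le_max lexx.
rewrite /loc_max; apply: le_trans (bigmax_ge_id _ _ _ _).
exact: bigmax_ge_id.
Qed.

Lemma loc_maxN x y i : loc_max (- x) (- y) i = - loc_min x y i.
Proof.
rewrite /loc_max /loc_min.
have -> : \big[Num.max/(- y) i 0]_(j in nbrs i) (- y) j 0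
    = - \big[Num.min/y i 0]_(j in nbrs i) y j 0.
  by rewrite mxE; elim/big_rec2: _ => // j a b _ ->; rewrite mxE oppr_min.
by elim/big_rec2: _ => // j a b _ ->; rewrite mxE oppr_min.
Qed.

End Limiter.

(** * The maximum principle for one abstract row *)

Section Row.
Context {R : realType} {Omega : set (R * R)} {Th : triangulation Omega}.
Local Notation N := (nnodes Th).
Variables (M S C E c : 'M[R]_N) (k mu sigma : R) (i : 'I_N).

(** A common form of both equations. The state row has [C] = tau, [E] = d and weights |d|; the
    adjoint row has [C] = -tau, [E] = -d^ and weights d^, where d^ is the entry of [diffhatM]. *)
Definition afc_row (x y : 'cV[R]_N) (L : R) : Prop :=
  let ML := diag_mx (\row_a \sum_b M a b) in
  ((ML + k *: (mu *: S + C + E + sigma *: ML)) *m x) i 0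
  = (ML *m y) i 0 + k * L
    + k * (\sum_(j | j != i) afactor c x x i j * E i j * (x j 0 - x i 0))
    + gbar M x y i 0.

Lemma afc_rowN x y L : afc_row x y L -> afc_row (- x) (- y) (- L).
Proof.
rewrite /afc_row /= !mulmxN => h; rewrite mxE h [in RHS]mxE.
have -> : gbar M (- x) (- y) i 0 = - gbar M x y i 0.
  rewrite !mxE -sumrN; apply: eq_bigr => j _.
  by rewrite -opprD afactorN !mxE; ring.
have -> : \sum_(j | j != i) afactor c (- x) (- x) i j * E i j
      * ((- x) j 0 - (- x) i 0) =
    - \sum_(j | j != i) afactor c x x i j * E i j * (x j 0 - x i 0).
  by rewrite -sumrN; apply: eq_bigr => j _; rewrite afactorN !mxE; ring.
ring.
Qed.

Hypotheses (hi : interior_node i) (k0 : 0 <= k) (mu0 : 0 <= mu)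
  (M0 : forall a b, 0 <= M a b) (Mii : 0 < M i i)
  (S0 : forall j, j != i -> S i j <= 0) (Srow : \sum_j S i j = 0)
  (CE0 : forall j, j != i -> C i j + E i j <= 0)
  (Crow : \sum_j C i j = 0) (Erow : \sum_j E i j = 0)
  (c0 : forall a b, b != a -> 0 <= c a b)
  (cE : forall j, j != i -> c i j = `|E i j|)
  (loc : forall j, j != i -> j \notin nbrs i ->
     [/\ M i j = 0, S i j = 0, C i j = 0 & E i j = 0]).

Lemma mulmx_zero_rowsum (A : 'M[R]_N) (x : 'cV[R]_N) : \sum_j A i j = 0 ->
  (A *m x) i 0 = \sum_(j | j != i) A i j * (x j 0 - x i 0).
Proof.
move=> A0; rewrite mxE.
transitivity (\sum_j A i j * (x j 0 - x i 0)).
  under [RHS]eq_bigr do rewrite mulrBr.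
  by rewrite sumrB -mulr_suml A0 mul0r subr0.
by rewrite (bigD1 i) //= subrr mulr0 add0r.
Qed.

(** The assumption [0 <= sigma * x i 0] serves both regimes: for [sigma >= 0] it follows from
    [x i 0 > 0], which is where the comparison with 0 enters, and for [sigma = 0] it is trivial. *)
Lemma afc_row_no_max x y L : afc_row x y L -> L <= 0 -> 0 <= sigma * x i 0 ->
  (forall j, j \in nbrs i -> x j 0 < x i 0) -> y i 0 < x i 0 -> False.
Proof.
move=> h L0 sx xlt ylt.
set m := \sum_b M i b.
have m0 : 0 < m.
  by rewrite /m (bigD1 i) //= ltr_wpDr // sumr_ge0.
have diffusive : 0 <= mu * \sum_(j | j != i) S i j * (x j 0 - x i 0)
    + \sum_(j | j != i) (C i j + E i j) * (x j 0 - x i 0).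
  have cmp (A : 'I_N -> R) : (forall j, j != i -> A j <= 0) ->
      (forall j, j != i -> j \notin nbrs i -> A j = 0) ->
      0 <= \sum_(j | j != i) A j * (x j 0 - x i 0).
    move=> A0 Aloc; apply: sumr_ge0 => j ji.
    have [jn|/(Aloc j ji)->] := boolP (j \in nbrs i); last by rewrite mul0r.
    by apply: mulr_le0; [exact: A0|rewrite subr_le0; exact/ltW/xlt].
  by rewrite addr_ge0 ?mulr_ge0 ?cmp // => j ji jn;
    have [_ s0 t0 e0] := loc ji jn; rewrite ?t0 ?e0 ?addr0.
(* Since [c i j] is the modulus of [E i j], a nonzero entry gives a positive flux towards each
   neighbour, and the limiter cancels it. *)
have limited : \sum_(j | j != i) afactor c x x i j * E i j * (x j 0 - x i 0) = 0.
  apply: big1 => j ji; have [jn|jn] := boolP (j \in nbrs i); last first.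
    by have [_ _ _ ->] := loc ji jn; rewrite mulr0 mul0r.
  have [->|E0] := eqVneq (E i j) 0; first by rewrite mulr0 mul0r.
  rewrite afactor_local_max ?mul0r // => [l /xlt/ltW //|].
  by rewrite /flux cE // mulr_gt0 ?normr_gt0 // subr_gt0 xlt.
(* The mass fluxes are those of [x - y], while the limiter tests the maximum of [x]. Positive fluxes
   are cancelled; nonpositive ones keep a nonnegative factor. *)
have antidiff : gbar M x y i 0 <= 0.
  rewrite mxE; apply: sumr_le0 => j ji.
  have [jn|jn] := boolP (j \in nbrs i); last first.
    by have [-> _ _ _] := loc ji jn; rewrite mulr0 mul0r.
  have -> : x i 0 - y i 0 - (x j 0 - y j 0) = (x - y) i 0 - (x - y) j 0.
    by rewrite !mxE.
  rewrite -mulrA -/(flux M (x - y) i j).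
  have [f0|f0] := leP (flux M (x - y) i j) 0.
    by rewrite mulr_ge0_le0 //; case/andP: (afactor_itv (x - y) x i j (fun a b _ => M0 a b)).
  by rewrite afactor_local_max ?mul0r // => l /xlt/ltW.
move: h; rewrite /afc_row /= limited mulr0 addr0.
rewrite mulmxDl -scalemxAl !mulmxDl -!scalemxAl.
rewrite !mul_diag_mx !mxE -/m.
move: (mulmx_zero_rowsum x Srow) (mulmx_zero_rowsum x Crow)
  (mulmx_zero_rowsum x Erow); rewrite !mxE => -> -> ->.
move: diffusive; under [X in _ + X]eq_bigr do rewrite mulrDl.
rewrite big_split /=.
move: antidiff; rewrite mxE.
set s1 := \sum_(j | j != i) _ ; set s2 := \sum_(j | j != i) _.
set s3 := \sum_(j | j != i) _; set s4 := \sum_(j | j != i) _.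
move=> s10 diffusive h.
(* This lumped increment is the only strict term, and the contradiction comes from it. *)
have h1 : 0 < m * (x i 0 - y i 0) by rewrite mulr_gt0 // subr_gt0.
have h2 : k * L <= 0 by rewrite mulr_ge0_le0.
have h3 : 0 <= k * (mu * s2 + (s3 + s4)) by rewrite mulr_ge0.
have h4 : 0 <= k * (sigma * x i 0 * m) by exact: mulr_ge0 k0 (mulr_ge0 sx (ltW m0)).
have : m * (x i 0 - y i 0) + k * (mu * s2 + (s3 + s4)) + k * (sigma * x i 0 * m)
  = k * L + s1.
  rewrite mulrBr -addrA -mulrDr.
  have -> : mu * s2 + (s3 + s4) + sigma * x i 0 * m
    = mu * s2 + s3 + s4 + sigma * (m * x i 0) by ring.
  move: h; set z := k * _; lra.
lra.
Qed.

Lemma afc_row_le_max x y L : afc_row x y L -> L <= 0 ->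
  (0 <= sigma -> x i 0 <= Num.max 0 (loc_max x y i)) /\
  (sigma = 0 -> x i 0 <= loc_max x y i).
Proof.
move=> h L0; have [hx hy] := loc_max_ge x y i; split => s0; rewrite leNgt.
  rewrite gt_max; apply/negP => /andP[x0 xm].
  apply: (afc_row_no_max h) => // [|j /hx|]; first by rewrite mulr_ge0 // ltW.
    by move/le_lt_trans; exact.
  exact: le_lt_trans xm.
apply/negP => xm.
apply: (afc_row_no_max h) => // [|j /hx|]; first by rewrite s0 mul0r.
  by move/le_lt_trans; exact.
exact: le_lt_trans xm.
Qed.

End Row.

Section RowMin.
Context {R : realType} {Omega : set (R * R)} {Th : triangulation Omega}.
Local Notation N := (nnodes Th).
Variables (M S C E c : 'M[R]_N) (k mu sigma : R) (i : 'I_N).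

(** The upper bound enters as a hypothesis on arbitrary vectors and loads, so that it can be applied
    to [- x], [- y], [- L] without restating the sign conditions on the matrices. *)
Lemma afc_row_ge_min x y L :
  (forall x' y' L', afc_row M S C E c k mu sigma i x' y' L' -> L' <= 0 ->
    (0 <= sigma -> x' i 0 <= Num.max 0 (loc_max x' y' i)) /\
    (sigma = 0 -> x' i 0 <= loc_max x' y' i)) ->
  afc_row M S C E c k mu sigma i x y L -> 0 <= L ->
  (0 <= sigma -> Num.min 0 (loc_min x y i) <= x i 0) /\
  (sigma = 0 -> loc_min x y i <= x i 0).
Proof.
move=> H /afc_rowN /H; rewrite oppr_le0 => /[apply] -[h1 h2].
split=> [/h1|/h2]; rewrite loc_maxN mxE ?lerN2 //.
by rewrite lerNl oppr_max oppr0 opprK.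
Qed.

End RowMin.

(** * Integrability and sign of integrals over sets of finite measure *)

Section Integration.
Local Open Scope ereal_scope.
Context d (T : measurableType d) (R : realType) (nu : {measure set T -> \bar R}).
Implicit Types (D : set T) (f g : T -> R).

Lemma bounded_onI D f (K : R) : (forall x, D x -> `|f x| <= K)%R ->
  [bounded f x | x in D].
Proof.
move=> h; exists K; split; first exact: num_real.
by move=> c Kc x Dx; exact: le_trans (h x Dx) (ltW Kc).
Qed.

Lemma integrable_bounded D f (K : R) : measurable D -> nu D < +oo ->
  measurable_fun D f -> (forall x, D x -> `|f x| <= K)%R ->
  nu.-integrable D (EFin \o f).
Proof.
by move=> mD fD mf /bounded_onI; exact: measurable_bounded_integrable.
Qed.

Lemma integrable_mulr_bounded D f g (K : R) : measurable D ->
  nu.-integrable D (EFin \o f) ->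
  measurable_fun D g -> (forall x, D x -> `|g x| <= K)%R ->
  nu.-integrable D (EFin \o (fun x => f x * g x)%R).
Proof.
move=> mD fi mg /bounded_onI bg.
by have := integrableMl mD fi mg bg; apply: eq_integrable.
Qed.

Lemma integrable_EFinD D f g : measurable D ->
  nu.-integrable D (EFin \o f) -> nu.-integrable D (EFin \o g) ->
  nu.-integrable D (EFin \o (fun x => f x + g x)%R).
Proof. by move=> mD fi gi; have := integrableD mD fi gi; exact: eq_integrable. Qed.

Lemma integrable_EFinN D f : measurable D ->
  nu.-integrable D (EFin \o f) -> nu.-integrable D (EFin \o (fun x => - f x)%R).
Proof. by move=> mD fi; have := integrableN fi; exact: eq_integrable. Qed.

Lemma integrable_EFinZ D f (a : R) : measurable D ->
  nu.-integrable D (EFin \o f) -> nu.-integrable D (EFin \o (fun x => a * f x)%R).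
Proof. by move=> mD fi; have := integrableZl mD a fi; exact: eq_integrable. Qed.

Lemma Rintegral_sum (I : eqType) (r : seq I) D (F : I -> T -> R) : measurable D ->
  (forall j, nu.-integrable D (EFin \o F j)) ->
  (\int[nu]_(x in D) (\sum_(j <- r) F j x) = \sum_(j <- r) \int[nu]_(x in D) F j x)%R.
Proof.
move=> mD Fi; elim: r => [|a r IH].
  rewrite big_nil /Rintegral.
  by under eq_integral do rewrite big_nil; rewrite integral0.
rewrite big_cons -IH -RintegralD //.
  by apply: eq_Rintegral => x _; rewrite big_cons.
have := @integrable_sum _ _ _ nu _ mD _ r xpredT _ (fun j _ => Fi j).
by apply: eq_integrable => // x _; rewrite /= sumEFin.
Qed.

(** Deleting the exceptional null set leaves the integral unchanged, and on the rest the sign holds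
    pointwise. *)
Lemma Rintegral_ae_le0 D f : measurable D -> nu.-integrable D (EFin \o f) ->
  ae_on nu D (fun x => f x <= 0)%R -> (\int[nu]_(x in D) f x <= 0)%R.
Proof.
move=> mD fi [Z [mZ Z0 hZ]]; rewrite -oppr_ge0.
rewrite /Rintegral (negligible_integral mZ mD fi Z0).
have mDZ : measurable (D `\` Z) by exact: measurableD.
have fiZ : nu.-integrable (D `\` Z) (EFin \o f).
  by apply: integrableS fi => // x [].
rewrite -mulN1r -/(Rintegral nu (D `\` Z) f) -RintegralZl //.
apply: Rintegral_ge0 => x [Dx nZx].
rewrite mulN1r oppr_ge0 leNgt; apply/negP => f0; apply: nZx; apply: hZ => /=.
by move/(_ Dx); rewrite leNgt f0.
Qed.

Lemma Rintegral_ae_ge0 D f : measurable D -> nu.-integrable D (EFin \o f) ->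
  ae_on nu D (fun x => 0 <= f x)%R -> (0 <= \int[nu]_(x in D) f x)%R.
Proof.
move=> mD fi f0; rewrite -oppr_le0 -mulN1r -RintegralZl //.
apply: Rintegral_ae_le0 => //; first exact: integrable_EFinZ.
by move: f0; rewrite /ae_on; apply: filterS => x h Dx; rewrite mulN1r oppr_le0 h.
Qed.

Lemma Linf_integrable D f : measurable D -> nu D < +oo -> Linf nu D f ->
  nu.-integrable D (EFin \o f).
Proof.
move=> mD Dfin /andP[]; rewrite !inE /= => mf hf.
have mDf : measurable_fun D f by exact/(measurable_restrictT _ mD).
have [K hK] : exists K : R, {ae nu, forall x, D x -> `|f x| <= K}%R.
  move: hf; rewrite /finite_norm unlock /Lnorm.
  (* The definition of the sup norm distinguishes whether the whole space is null; if it is, any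
     bound holds almost everywhere. *)
  have [_|T0 _] := ltP 0 (nu [set: T]).
    move/ess_supr_bounded => [K hK]; exists K.
    by apply: filterS hK => x /= + Dx; rewrite patchE mem_set.
  exists 0%R; exists [set: T]; split => //.
  by apply/eqP; rewrite eq_le T0 measure_ge0.
apply/integrableP; split; first exact/measurable_EFinP.
apply: (@le_lt_trans _ _ (\int[nu]_(x in D) `|K|%:E)).
  apply: ae_ge0_le_integral => //.
  - exact/measurableT_comp/measurable_EFinP.
  - by apply: filterS hK => x hx Dx; rewrite /= lee_fin (le_trans (hx Dx)) // ler_norm.
by rewrite integral_cst // lte_mul_pinfty.
Qed.

(** On a set of finite measure [f ^+ 2 + 1] is integrable and dominates the modulus of [f]. *)
Lemma L2_integrable D f : measurable D -> nu D < +oo -> L2 nu D f ->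
  nu.-integrable D (EFin \o f).
Proof.
move=> mD Dfin Lf; have := Lfun2_integrable_sqr Lf => /= sq.
have /andP[] := Lf; rewrite !inE /= => mf _.
have mDf : measurable_fun D f by exact/(measurable_restrictT _ mD).
have sqD : nu.-integrable D (EFin \o (fun x => f x ^+ 2 + 1)%R).
  apply: integrable_EFinD => //; last first.
    by apply: (@integrable_bounded _ _ 1) => // x _; rewrite normr1.
  apply: (eq_integrable mD (fun x => ((f \_ D) x ^+ 2)%:E)).
    by move=> x xD; rewrite /= patchE xD.
  exact: integrableS sq.
apply: le_integrable sqD => //; first exact/measurable_EFinP.
move=> x Dx; rewrite /= lee_fin [leRHS]ger0_norm ?addr_ge0 ?sqr_ge0 //.
by rewrite -[(f x ^+ 2)%R]real_normK ?num_real //; nra.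
Qed.

End Integration.

(** * Plane Lebesgue measure of open and bounded sets *)

Section PlaneMeasure.
Context {R : realType}.
Local Notation mu := (leb2 R).
Local Notation plane := (measurableTypeR R * measurableTypeR R)%type.
Implicit Types (A U : set (R * R)).

(** The sigma-algebra here is the product one, so the open set is exhibited as the countable union
    of the boxes inside it with rational centre and radius 1/(m+1). *)
Lemma open_measurable_plane A : open A -> measurable (A : set plane).
Proof.
move=> oA.
pose box (p : rat * rat * nat) : set (R * R) :=
  ball (ratr p.1.1 : R) p.2.+1%:R^-1 `*` ball (ratr p.1.2 : R) p.2.+1%:R^-1.
pose cell p : set (R * R) := if `[< box p `<=` A >] then box p else set0.
have -> : A = \bigcup_p cell p.
  apply/seteqP; split=> [x Ax|x [p _]]; last first.
    by rewrite /cell; case: asboolP => // h /h.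
  have /nbhs_ballP[e /= e0 eA] : nbhs x A by exact: open_nbhs_nbhs.
  (* Points of a box reach [x] through its centre, at the cost of two radii; hence each radius must
     stay below [e / 2]. *)
  have e20 : 0 < e / 2 by rewrite divr_gt0.
  have [m] := ltr_add_invr e20; rewrite add0r => me.
  have rat_near (z : R) : exists q : rat, `|ratr q - z| < m.+1%:R^-1.
    have [|q] := @rat_in_itvoo R (z - m.+1%:R^-1) (z + m.+1%:R^-1).
      by rewrite ltrD2l gtrN // invr_gt0.
    by rewrite in_itv /= => /andP[h1 h2]; exists q; rewrite ltr_distl h1.
  have [p hp] := rat_near x.1; have [q hq] := rat_near x.2.
  exists (p, q, m) => //; rewrite /cell asboolT; first by split.
  move=> y [/= y1 y2]; apply: eA; split => /=.
    rewrite -ball_normE /= in y1 *.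
    apply: (le_lt_trans (ler_distD (ratr p) _ _)).
    by rewrite (splitr e) ltrD // (lt_trans _ me) // distrC.
  rewrite -ball_normE /= in y2 *.
  apply: (le_lt_trans (ler_distD (ratr q) _ _)).
  by rewrite (splitr e) ltrD // (lt_trans _ me) // distrC.
apply: countable_bigcupT_measurable => // p; rewrite /cell.
by case: ifP => // _; apply: measurableX; exact: measurable_ball.
Qed.

Lemma leb2_setX (B C : set (measurableTypeR R)) : measurable B -> measurable C ->
  mu (B `*` C) = (lebesgue_measure B * lebesgue_measure C)%E.
Proof. by move=> mB mC; exact: product_measure1E. Qed.

Lemma leb2_bounded A : measurable (A : set plane) -> bounded_set A ->
  (mu A < +oo)%E.
Proof.
move=> mA [K [_ hK]].
(* Boundedness gives the bound [K + 1], and [|K| + 2] is a positive radius strictly above it. *)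
have hA : A `<=` ball 0 (`|K| + 2) `*` ball 0 (`|K| + 2).
  move=> x Ax; have := hK (K + 1) _ x Ax; rewrite ltrDl ltr01 => /(_ isT).
  rewrite /= prod_normE ge_max => /andP[h1 h2].
  by split; rewrite -ball_normE /= sub0r normrN; have := ler_norm K; lra.
have mB : measurable (ball (0 : R) (`|K| + 2) : set (measurableTypeR R)).
  exact: measurable_ball.
apply: (@le_lt_trans _ _ (mu (ball 0 (`|K| + 2) `*` ball 0 (`|K| + 2)))).
  by apply: le_measure => //; rewrite inE //; exact: measurableX.
rewrite leb2_setX //.
by rewrite lebesgue_measure_ball ?addr_ge0 // -EFinM ltry.
Qed.

Lemma leb2_open_gt0 U : open U -> U !=set0 -> (0 < mu U)%E.
Proof.
move=> oU [x Ux]; have /nbhs_ballP[e /= e0 eU] : nbhs x U by exact: open_nbhs_nbhs.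
have mB (c : R) : measurable (ball c e : set (measurableTypeR R)).
  exact: measurable_ball.
apply: (@lt_le_trans _ _ (mu (ball x.1 e `*` ball x.2 e))).
  rewrite leb2_setX // !lebesgue_measure_ball ?ltW //.
  by rewrite -EFinM lte_fin mulr_gt0 // pmulrn_lgt0.
apply: le_measure; rewrite ?inE.
- exact: measurableX.
- exact: open_measurable_plane.
- by move=> y [y1 y2]; apply: eU.
Qed.

End PlaneMeasure.

(** * Entries and row sums of the finite element matrices, and load vectors *)

Section Assembly.
Context {R : realType} {Omega : set (R * R)} {Th : triangulation Omega}.
Local Notation N := (nnodes Th).
Local Notation mu := (leb2 R).
Local Notation plane := (measurableTypeR R * measurableTypeR R)%type.
Hypothesis hOmega : convex_polygonal_domain Omega.
Variable phi : 'I_N -> R * R -> R.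
Hypothesis hphi : nodal_basis phi.
Implicit Types (i j : 'I_N) (t : {set 'I_N}) (x : R * R) (f g : R * R -> R).

Let oO : open Omega. Proof. by case: hOmega. Qed.

Let mO : measurable (Omega : set plane).
Proof. exact: open_measurable_plane. Qed.

Let finO : (mu Omega < +oo)%E.
Proof. by apply: leb2_bounded => //; case: hOmega. Qed.

Let cl x : Omega x -> closure Omega x.
Proof. exact: subset_closure. Qed.

(** Such a function takes finitely many values: a preimage is a finite union of open triangles,
    together with the remaining set when it contains the value 0. *)
Lemma measurable_elementwise_cst (h : plane -> R) :
  (forall t, t \in elements Th ->
     exists c, forall x, interior (triangle t) x -> h x = c) ->
  (forall x, (forall t, t \in elements Th -> ~ interior (triangle t) x) ->
     h x = 0) ->
  measurable_fun [set: plane] h /\ exists K : R, forall x, `|h x| <= K.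
Proof.
move=> hin hout.
have [c hc] : {c : {set 'I_N} -> R & forall t, t \in elements Th ->
    forall x, interior (triangle t) x -> h x = c t}.
  apply: (@choice _ _ (fun t c => t \in elements Th ->
    forall x, interior (triangle t) x -> h x = c)) => t.
  by have [/hin[c]|] := boolP (t \in elements Th); [exists c|exists 0].
pose V := \bigcup_(t in [set` elements Th]) interior (triangle t).
have mI t : measurable (interior (triangle t) : set plane).
  by apply: open_measurable_plane; exact: open_interior.
(* Intersecting with a constant set, which is everything or empty, encodes that a piece is included
   on condition [P]. *)
have mP (A : set plane) (P : Prop) : measurable A ->
    measurable (A `&` [set _ | P]).
  move=> mA; apply: measurableI => //; have [p|p] := pselect P.
    by rewrite (_ : [set _ | _] = setT) //; apply/seteqP; split.
  by rewrite (_ : [set _ | _] = set0) //; apply/seteqP; split.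
have mV : measurable (V : set plane).
  by apply: fin_bigcup_measurable => // t _; exact: mI.
split.
  move=> _ Y mY; rewrite setTI.
  rewrite (_ : _ @^-1` _ =
    (\bigcup_(t in [set` elements Th]) (interior (triangle t) `&` [set _ | Y (c t)]))
    `|` (~` V `&` [set _ | Y 0])).
    apply: measurableU; first by apply: fin_bigcup_measurable => // t _; exact: mP.
    by apply: mP; exact: measurableC.
  apply/seteqP; split=> x.
    move=> /= Yx; have [[t tT tx]|Vx] := pselect (V x).
      by left; exists t => //; split => //=; rewrite -(hc t tT x tx).
    right; split => //=; rewrite -(hout x) // => t tT tx.
    by apply: Vx; exists t.
  case=> [[t tT [tx /=]]|[Vx /=]]; first by rewrite -(hc t tT x tx).
  by rewrite -(hout x) // => t tT tx; apply: Vx; exists t.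
exists (\sum_(t in elements Th) `|c t|) => x.
have [[t tT tx]|Vx] := pselect (V x).
  rewrite (hc t tT x tx) (bigD1 t) //= lerDl.
  by apply: sumr_ge0.
rewrite hout ?normr0; first exact: sumr_ge0.
by move=> t tT tx; apply: Vx; exists t.
Qed.

(** The map [p] stands for a coordinate projection; [p 0 = 0] matches the default value of
    [grad]. *)
Lemma measurable_bounded_grad_hat j (p : R * R -> R) : p 0 = 0 ->
  measurable_fun [set: plane] (fun x => p (grad Th (phi j) x)) /\
  exists K : R, forall x, `|p (grad Th (phi j) x)| <= K.
Proof.
move=> p0; apply: measurable_elementwise_cst => [t tT|x hx]; last first.
  by rewrite grad_off.
have [_ /(_ t tT)[a [v hv]] _] := hphi j.
by exists (p v) => x tx; rewrite (grad_affine tT tx hv).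
Qed.

(** A hat is continuous only relative to the closure of [Omega], so its preimages are traces of open
    sets. This suffices for measurability on [Omega]. *)
Lemma hat_preimage_open i (B : set R) : open B ->
  exists2 V : set (R * R), open V & Omega `&` phi i @^-1` B = V `&` Omega.
Proof.
move=> oB; have [hc _ _] := hphi i.
have /continuousP/(_ B oB)/open_subspaceP[V oV VE] := hc; exists V => //.
apply/seteqP; split=> x.
  move=> [Ox Bx]; split => //.
  have : (phi i @^-1` B `&` closure Omega) x by split => //; exact: cl.
  by rewrite -VE => -[].
move=> [Vx Ox]; split => //.
have : (V `&` closure Omega) x by split => //; exact: cl.
by rewrite VE => -[].
Qed.

Lemma measurable_hat i : measurable_fun (Omega : set plane) (phi i).
Proof.
apply: (measurability _ (RGenOpens.measurableE R)) => _ [_ [a [b ->] <-]].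
have [V oV ->] := hat_preimage_open i (@interval_open _ (BRight a) (BLeft b) isT isT).
by apply: measurableI => //; exact: open_measurable_plane.
Qed.

Lemma hat_norm_le1 i x : Omega x -> `|phi i x| <= 1.
Proof. by move=> /cl Ox; rewrite ger0_norm ?(hat_ge0 hphi) ?(hat_le1 hphi). Qed.

Lemma integrable_mul_hat f i : mu.-integrable Omega (EFin \o f) ->
  mu.-integrable Omega (EFin \o (fun x => f x * phi i x)).
Proof.
move=> fi; apply: integrable_mulr_bounded fi (measurable_hat i) _ => //.
exact: hat_norm_le1.
Qed.

Lemma integrable_hat i : mu.-integrable Omega (EFin \o phi i).
Proof.
apply: (@integrable_bounded _ _ _ mu Omega (phi i) 1) => //.
  exact: measurable_hat.
exact: hat_norm_le1.
Qed.

Lemma integrable_mass i j :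
  mu.-integrable Omega (EFin \o (fun x => phi i x * phi j x)).
Proof. exact/integrable_mul_hat/integrable_hat. Qed.

Lemma integrable_mul_grad f j (p : R * R -> R) : p 0 = 0 ->
  mu.-integrable Omega (EFin \o f) ->
  mu.-integrable Omega (EFin \o (fun x => f x * p (grad Th (phi j) x))).
Proof.
move=> /(measurable_bounded_grad_hat j)[mp [K hK]] fi.
apply: integrable_mulr_bounded fi _ (fun x _ => hK x) => //.
exact: measurable_funTS.
Qed.

Lemma integrable_dot_grad (u : R * R -> R * R) j :
  mu.-integrable Omega (EFin \o (fun x => (u x).1)) ->
  mu.-integrable Omega (EFin \o (fun x => (u x).2)) ->
  mu.-integrable Omega (EFin \o (fun x => dot (u x) (grad Th (phi j) x))).
Proof.
move=> u1 u2; apply: integrable_EFinD => //.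
  exact: (@integrable_mul_grad _ _ fst).
exact: (@integrable_mul_grad _ _ snd).
Qed.

Lemma integrable_grad i (p : R * R -> R) : p 0 = 0 ->
  mu.-integrable Omega (EFin \o (fun x => p (grad Th (phi i) x))).
Proof.
move=> /(measurable_bounded_grad_hat i)[mp [K hK]].
apply: (@integrable_bounded _ _ _ _ _ _ K) => //.
exact: measurable_funTS.
Qed.

Lemma massM_ge0 i j : 0 <= massM phi i j.
Proof.
rewrite mxE; apply: Rintegral_ge0 => x /cl Ox.
by rewrite mulr_ge0 ?(hat_ge0 hphi).
Qed.

(** The hat exceeds 1/2 on an open subset of [Omega] containing the node, so its square is at least
    1/4 on a set of positive measure. *)
Lemma massM_gt0 i : interior_node i -> 0 < massM phi i i.
Proof.
move/asboolP => Oi; rewrite mxE /ip.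
have [V oV VE] := hat_preimage_open i (@open_gt R (1 / 2)).
have oU : open (Omega `&` V) by exact: openI.
have mV : measurable (V : set plane) by exact: open_measurable_plane.
have U0 : (0 < mu (Omega `&` V))%E.
  apply: leb2_open_gt0 => //; exists (node i); rewrite setIC -VE; split => //=.
  by have [_ _ ->] := hphi i; rewrite eqxx /=; lra.
have Ufin : (mu (Omega `&` V) < +oo)%E.
  by apply: le_lt_trans finO; apply: le_measure; rewrite ?inE //; exact: measurableI.
have c_gt0 : 0 < \int[mu]_(x in Omega `&` V) (1 / 4).
  by rewrite Rintegral_cst ?mulr_gt0 ?fine_gt0 ?U0 //; exact: measurableI.
apply: (lt_le_trans c_gt0); rewrite Rintegral_mkcondr.
apply: le_Rintegral => //; [|exact: integrable_mass|].
  apply: (@integrable_bounded _ _ _ _ _ _ 1) => //.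
    by apply/(measurable_restrict _ mV mO); exact: measurable_cst.
  move=> x _; rewrite patchE; case: ifP => _; rewrite ?normr0 //.
  by rewrite ger0_norm; lra.
move=> x Ox; rewrite patchE; case: ifPn => [/set_mem Vx|_].
  have : (V `&` Omega) x by [].
  rewrite -VE => -[_ /= h]; nra.
by rewrite mulr_ge0 ?(hat_ge0 hphi) //; exact: cl.
Qed.

Lemma massM_nbrs i j : j != i -> j \notin nbrs i -> massM phi i j = 0.
Proof.
(* The right-hand 0 is written as the integral of the constant 0, to compare integrands. *)
move=> ji hn; rewrite mxE /ip -[RHS](mul0r (fine (mu Omega))) -Rintegral_cst //.
by apply: eq_Rintegral => x /set_mem/cl Ox; rewrite (hat_nbrs hphi Ox ji hn).
Qed.

Lemma stiffM_le0 i j (F : set (triangulation Omega)) : acute F -> F Th ->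
  j != i -> stiffM phi i j <= 0.
Proof.
move=> hac hF ji; rewrite mxE; apply: Rintegral_ae_le0 => //.
  by apply: integrable_dot_grad; [exact: (@integrable_grad i fst)|
                                  exact: (@integrable_grad i snd)].
by apply: aeW => x _; exact: grad_hat_acute hac hF hphi ji.
Qed.

Lemma stiffM_nbrs i j : j != i -> j \notin nbrs i -> stiffM phi i j = 0.
Proof.
move=> ji hn; rewrite mxE -[RHS](mul0r (fine (mu Omega))) -Rintegral_cst //.
by apply: eq_Rintegral => x _; apply: grad_hat_nbrs.
Qed.

Lemma stiffM_rowsum i : \sum_j stiffM phi i j = 0.
Proof.
under eq_bigr do rewrite mxE.
rewrite -Rintegral_sum // => [|j].
  rewrite -[RHS](mul0r (fine (mu Omega))) -Rintegral_cst //.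
  by apply: eq_Rintegral => x _; rewrite -dot_sumr (grad_hat_sum hphi) dot0r.
by apply: integrable_dot_grad; [exact: (@integrable_grad i fst)|
                                exact: (@integrable_grad i snd)].
Qed.

Lemma convM_nbrs u i j : j != i -> j \notin nbrs i -> convM u phi i j = 0.
Proof.
move=> ji hn; rewrite mxE /ip -[RHS](mul0r (fine (mu Omega))) -Rintegral_cst //.
apply: eq_Rintegral => x _.
by have [->|->] := hat_grad_nbrs hphi x ji hn; rewrite ?dot0r ?mul0r ?mulr0.
Qed.

Lemma convM_rowsum (sigma sigma0 : R) u i : admissible_field Omega sigma sigma0 u ->
  \sum_j convM u phi i j = 0.
Proof.
case=> -[u1 _] [u2 _] _; under eq_bigr do rewrite mxE.
rewrite -Rintegral_sum // => [|j].
  rewrite -[RHS](mul0r (fine (mu Omega))) -Rintegral_cst //.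
  apply: eq_Rintegral => x _.
  by rewrite -mulr_suml -dot_sumr (grad_hat_sum hphi) dot0r mul0r.
by apply/integrable_mul_hat/integrable_dot_grad; exact: Linf_integrable.
Qed.

(** The hat is nonnegative and vanishes off the patch, so a sign of [f] on the patch passes to the
    integral. *)
Lemma loadV_le0 f i : mu.-integrable Omega (EFin \o f) ->
  ae_patch i (fun x => f x <= 0) -> loadV f phi i 0 <= 0.
Proof.
move=> fi f0; rewrite mxE; apply: Rintegral_ae_le0 => //.
  exact: integrable_mul_hat.
move: f0; rewrite /ae_patch /ae_on; apply: filterS => x h Ox.
have [px|px] := pselect (patch_of i x).
  by rewrite mulr_le0_ge0 ?h // (hat_ge0 hphi) //; exact: cl.
by rewrite (hat_off_patch hphi (cl Ox) px) mulr0.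
Qed.

Lemma loadV_ge0 f i : mu.-integrable Omega (EFin \o f) ->
  ae_patch i (fun x => 0 <= f x) -> 0 <= loadV f phi i 0.
Proof.
move=> fi f0; rewrite mxE; apply: Rintegral_ae_ge0 => //.
  exact: integrable_mul_hat.
move: f0; rewrite /ae_patch /ae_on; apply: filterS => x h Ox.
have [px|px] := pselect (patch_of i x).
  by rewrite mulr_ge0 ?h // (hat_ge0 hphi) //; exact: cl.
by rewrite (hat_off_patch hphi (cl Ox) px) mulr0.
Qed.

Lemma integrable_fe_fun (a : 'cV[R]_N) :
  mu.-integrable Omega (EFin \o fe_fun phi a).
Proof.
have := @integrable_sum _ _ _ mu _ mO _ (index_enum 'I_N) xpredT
  (fun j x => (a j 0 * phi j x)%:E)
  (fun j _ => integrable_EFinZ (a j 0) mO (integrable_hat j)).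
by apply: eq_integrable => // x _; rewrite /= sumEFin.
Qed.

(** The right side is the load of the adjoint row; the left side shows it as the load of the
    difference whose sign is assumed. *)
Lemma loadV_fe_fun (a : 'cV[R]_N) f i : mu.-integrable Omega (EFin \o f) ->
  loadV (fun x => fe_fun phi a x - f x) phi i 0
  = (massM phi *m a) i 0 - loadV f phi i 0.
Proof.
move=> fi; rewrite !mxE /ip.
under eq_Rintegral do rewrite mulrBl.
rewrite RintegralB //; [|exact/integrable_mul_hat/integrable_fe_fun|
  exact: integrable_mul_hat].
congr (_ - _).
transitivity (\sum_j \int[mu]_(x in Omega) (a j 0 * (phi i x * phi j x))).
  rewrite -Rintegral_sum // => [|j].
    apply: eq_Rintegral => x _; rewrite /fe_fun mulr_suml.
    by apply: eq_bigr => j _; ring.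
  exact/integrable_EFinZ/integrable_mass.
apply: eq_bigr => j _; rewrite RintegralZl //; last exact: integrable_mass.
by rewrite mxE mulrC.
Qed.

End Assembly.

(** * The abstract row applied to the state and adjoint equations *)

Section MaximumPrinciple.
Context {R : realType} {Omega : set (R * R)} {Th : triangulation Omega}.
Local Notation N := (nnodes Th).
Variables (F : set (triangulation Omega)) (phi : 'I_N -> R * R -> R).
Hypotheses (hOmega : convex_polygonal_domain Omega) (hacute : acute F)
  (hTh : F Th) (hphi : nodal_basis phi).
Variables (k kappa sigma sigma0 : R) (u : R * R -> R * R) (i : 'I_N).
Hypotheses (k0 : 0 <= k) (kappa0 : 0 <= kappa) (hi : interior_node i)
  (hu : admissible_field Omega sigma sigma0 u).
Local Notation tau := (convM u phi).

Lemma nbrs_sym (a b : 'I_N) : (a \in nbrs b) = (b \in nbrs a).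
Proof.
rewrite !inE eq_sym; congr (_ && _); apply: eq_existsb => t.
by rewrite (andbC (a \in t)).
Qed.

Lemma zero_rowsum_sum (c : 'I_N -> 'I_N -> R) a :
  \sum_j zero_rowsum c a j = 0.
Proof.
rewrite (bigD1 a) //= mxE eqxx addrC; apply/eqP; rewrite subr_eq0; apply/eqP.
by apply: eq_bigr => j ja; rewrite mxE eq_sym (negPf ja).
Qed.

Lemma zero_rowsum_off (c : 'I_N -> 'I_N -> R) a j : j != a ->
  zero_rowsum c a j = c a j.
Proof. by move=> ja; rewrite mxE eq_sym (negPf ja). Qed.

Lemma convM_nbrs2 j : j != i -> j \notin nbrs i -> tau i j = 0 /\ tau j i = 0.
Proof.
by move=> ji hn; rewrite !(convM_nbrs hOmega hphi) // 1?eq_sym // nbrs_sym.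
Qed.

(** Mass and stiffness are common to both equations, so their conditions are discharged here once;
    those on convection and diffusion remain. *)
Lemma afc_row_bounds (C E c : 'M[R]_N) (x y : 'cV[R]_N) (L : R) :
  (forall j, j != i -> C i j + E i j <= 0) ->
  \sum_j C i j = 0 -> \sum_j E i j = 0 ->
  (forall a b, b != a -> 0 <= c a b) ->
  (forall j, j != i -> c i j = `|E i j|) ->
  (forall j, j != i -> j \notin nbrs i -> C i j = 0 /\ E i j = 0) ->
  afc_row (massM phi) (stiffM phi) C E c k kappa sigma i x y L ->
  (L <= 0 -> (0 <= sigma -> x i 0 <= Num.max 0 (loc_max x y i)) /\
             (sigma = 0 -> x i 0 <= loc_max x y i)) /\
  (0 <= L -> (0 <= sigma -> Num.min 0 (loc_min x y i) <= x i 0) /\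
             (sigma = 0 -> loc_min x y i <= x i 0)).
Proof.
move=> CE0 Crow Erow c0 cE loc.
have max x' y' L' : afc_row (massM phi) (stiffM phi) C E c k kappa sigma i x' y' L' ->
    L' <= 0 -> (0 <= sigma -> x' i 0 <= Num.max 0 (loc_max x' y' i)) /\
               (sigma = 0 -> x' i 0 <= loc_max x' y' i).
  apply: afc_row_le_max => //.
  - exact: massM_ge0.
  - exact: massM_gt0.
  - by move=> j; exact: (stiffM_le0 hOmega hphi hacute hTh).
  - exact: stiffM_rowsum.
  - move=> j ji hn; have [-> ->] := loc j ji hn.
    by rewrite (massM_nbrs hOmega hphi) // (stiffM_nbrs hOmega hphi).
move=> h; split; first exact: max.
exact: (afc_row_ge_min max h).
Qed.

Lemma state_row_bounds (s : R * R -> R) (x y : 'cV[R]_N) :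
  state_row kappa sigma k u phi s x y i ->
  let L := loadV s phi i 0 in
  (L <= 0 -> (0 <= sigma -> x i 0 <= Num.max 0 (loc_max x y i)) /\
             (sigma = 0 -> x i 0 <= loc_max x y i)) /\
  (0 <= L -> (0 <= sigma -> Num.min 0 (loc_min x y i) <= x i 0) /\
             (sigma = 0 -> loc_min x y i <= x i 0)).
Proof.
move=> h L.
apply: (@afc_row_bounds tau (Defs.diffM tau)
  (map_mx Num.norm (Defs.diffM tau))).
(* The minimum defining d_ij is at most -tau_ij. *)
- move=> j ji; rewrite zero_rowsum_off //.
  by rewrite addrC -lerBrDr sub0r !ge_min lexx.
- exact: convM_rowsum hu.
- exact: zero_rowsum_sum.
- by move=> a b _; rewrite mxE.
- by move=> j _; rewrite mxE.
- move=> j ji hn; have [t1 t2] := convM_nbrs2 ji hn.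
  by rewrite zero_rowsum_off // t1 t2 !oppr0 !minxx.
- move: h; rewrite /state_row /afc_row /= => ->.
  by rewrite [fbar _ _ _ _]mxE.
Qed.

Lemma adjoint_row_bounds (yd : R * R -> R) (a x y : 'cV[R]_N) :
  adjoint_row kappa sigma k u phi yd a x y i ->
  let L := (massM phi *m a) i 0 - loadV yd phi i 0 in
  (L <= 0 -> (0 <= sigma -> x i 0 <= Num.max 0 (loc_max x y i)) /\
             (sigma = 0 -> x i 0 <= loc_max x y i)) /\
  (0 <= L -> (0 <= sigma -> Num.min 0 (loc_min x y i) <= x i 0) /\
             (sigma = 0 -> loc_min x y i <= x i 0)).
Proof.
have oppE (A : 'M[R]_N) b j : (- A) b j = - A b j by rewrite mxE.
have dh0 b j : j != b -> 0 <= diffhatM tau b j.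
  by move=> jb; rewrite zero_rowsum_off // !le_max lexx !orbT.
move=> h L.
apply: (@afc_row_bounds (- tau) (- diffhatM tau) (diffhatM tau)).
(* The maximum defining the entry of [diffhatM] is at least -tau_ij. *)
- move=> j ji; rewrite !oppE zero_rowsum_off //.
  by rewrite subr_le0 !le_max lexx.
- under eq_bigr do rewrite mxE.
  by rewrite sumrN (convM_rowsum hOmega hphi _ hu) oppr0.
- under eq_bigr do rewrite mxE.
  by rewrite sumrN zero_rowsum_sum oppr0.
- exact: dh0.
- by move=> j ji; rewrite oppE normrN ger0_norm // dh0.
- move=> j ji hn; have [t1 t2] := convM_nbrs2 ji hn.
  rewrite !oppE zero_rowsum_off // t1 t2 !oppr0 !maxxx.
  by rewrite oppr0.
- move: h; rewrite /adjoint_row /afc_row /= => ->.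
  (* [fhatbar] uses the difference x_i - x_j; its sign is absorbed by [E = - diffhatM tau]. *)
  rewrite [fhatbar _ _ _ _]mxE /L mulrBr !addrA; congr (_ + _ * _ + _).
  by apply: eq_bigr => j _; rewrite oppE; ring.
Qed.

End MaximumPrinciple.

(** * The local discrete maximum principle *)

Unset Implicit Arguments.
Set Strict Implicit.

Theorem theorem3p1 (R : realType)
  (Omega : set (R * R)) (hOmega : convex_polygonal_domain Omega)
  (Tf mu sigma sigma0 lambda ua ub : R)
  (hTf : 0 < Tf) (hmu : 0 < mu) (hsigma : 0 <= sigma) (hsigma0 : 0 < sigma0)
  (hlambda : 0 < lambda) (huab : ua < ub)
  (b : R -> R * R -> R * R)
  (hb : forall t, 0 <= t <= Tf -> admissible_field Omega sigma sigma0 (b t))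
  (G yd : R -> R * R -> R)
  (hG : forall t, 0 <= t <= Tf -> L2 (leb2 R) Omega (G t))
  (hyd : forall t, 0 <= t <= Tf -> L2 (leb2 R) Omega (yd t))
  (B Bs : (R * R * R -> R) -> (R * R * R -> R))
  (hB : adjoint_L2 (leb3 R) (cylinder Omega Tf) B Bs)
  (Bt Bst : R -> (R * R -> R) -> (R * R -> R))
  (hBt : acts_at_fixed_times Omega Tf B Bt)
  (hBst : acts_at_fixed_times Omega Tf Bs Bst)
  (hBtad : forall t, 0 <= t <= Tf ->
     adjoint_L2 (leb2 R) Omega (Bt t) (Bst t))
  (F : set (triangulation Omega))
  (hshape : shape_regular F) (hquasi : quasi_uniform F) (hacute : acute F)
  (Th : triangulation Omega) (hTh : F Th)
  (phi : 'I_(nnodes Th) -> R * R -> R) (hphi : nodal_basis phi)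
  (N0 : nat) (hN0 : (1 <= N0)%N)
  (k : R) (hk : k = Tf / N0%:R)
  (sadj : nat -> R)
  (hsadj : forall n, (1 <= n <= N0)%N ->
     sadj n = n%:R * k \/ sadj n = n.-1%:R * k)
  (alpha beta : nat -> 'cV[R]_(nnodes Th)) (U : nat -> R * R -> R)
  (hsol : afc_solution phi mu sigma lambda ua ub k N0 b G yd Bt Bst sadj
            alpha beta U) :
  forall (n : nat) (i : 'I_(nnodes Th)),
    (1 <= n <= N0)%N -> interior_node i ->
    let tn := n%:R * k in
    let Y := fe_fun phi (alpha n) in
    let rhs := fun x => G tn x + Bt tn (U n) x in
    let amax := loc_max (alpha n) (alpha n.-1) i in
    let amin := loc_min (alpha n) (alpha n.-1) i in
    let bmax := loc_max (beta n.-1) (beta n) i in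
    let bmin := loc_min (beta n.-1) (beta n) i in
    (0 < sigma ->
      [/\ ae_patch i (fun x => rhs x <= 0) ->
            alpha n i 0 <= Num.max 0 amax,
          ae_patch i (fun x => 0 <= rhs x) ->
            Num.min 0 amin <= alpha n i 0,
          ae_patch i (fun x => Y x - yd tn x <= 0) ->
            beta n.-1 i 0 <= Num.max 0 bmax &
          ae_patch i (fun x => 0 <= Y x - yd tn x) ->
            Num.min 0 bmin <= beta n.-1 i 0]) /\
    (sigma = 0 ->
      [/\ ae_patch i (fun x => rhs x <= 0) -> alpha n i 0 <= amax,
          ae_patch i (fun x => 0 <= rhs x) -> amin <= alpha n i 0,
          ae_patch i (fun x => Y x - yd tn x <= 0) ->
            beta n.-1 i 0 <= bmax &
          ae_patch i (fun x => 0 <= Y x - yd tn x) ->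
            bmin <= beta n.-1 i 0]).
Proof.
move=> n i hn hi tn Y rhs amax amin bmax bmin.
have [_ _ /(_ n hn)[hstate hadj hU _]] := hsol.
have N0_gt0 : 0 < N0%:R :> R by rewrite ltr0n.
have k_gt0 : 0 < k by rewrite hk divr_gt0.
have k0 := ltW k_gt0.
have time m : (m <= N0)%N -> 0 <= m%:R * k <= Tf.
  move=> mN; rewrite mulr_ge0 //=.
  have -> : Tf = N0%:R * k by rewrite hk mulrCA divff ?mulr1 // gt_eqF.
  by rewrite ler_wpM2r // ler_nat.
have /andP[n1 nN] := hn.
have htn := time n nN.
(* Either admissible choice of the time level lies in [0, [Tf]], where the field is admissible. *)
have hsn : 0 <= sadj n <= Tf.
  by case: (hsadj n hn) => ->; apply: time; rewrite // (leq_trans (leq_pred n)).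
have oO : open Omega by case: hOmega.
have mO := open_measurable_plane oO.
have finO : (leb2 R Omega < +oo)%E by apply: leb2_bounded => //; case: hOmega.
have L2I f : L2 (leb2 R) Omega f -> (leb2 R).-integrable Omega (EFin \o f).
  exact: L2_integrable.
have [[BL2 _ _] _ _] := hBtad _ htn.
have rhsE : (fun x => Bt tn (U n) x + G tn x) = rhs.
  by apply/funext => x; rewrite addrC.
have irhs : (leb2 R).-integrable Omega (EFin \o rhs).
  by apply: integrable_EFinD => //; apply: L2I; [exact: hG|exact: BL2].
have iyd : (leb2 R).-integrable Omega (EFin \o yd tn) by apply/L2I/hyd.
have iY : (leb2 R).-integrable Omega (EFin \o (fun x => Y x - yd tn x)).
  apply: integrable_EFinD => //; first exact: integrable_fe_fun.
  exact: integrable_EFinN.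
have mu0 := ltW hmu.
have [smax smin] :=
  state_row_bounds hOmega hacute hTh hphi k0 mu0 hi (hb _ htn) (hstate i hi).
have [jmax jmin] :=
  adjoint_row_bounds hOmega hacute hTh hphi k0 mu0 hi (hb _ hsn) (hadj i hi).
(* The adjoint load becomes that of [Y - yd tn], so the sign assumption on the patch applies. *)
rewrite -(loadV_fe_fun hOmega hphi) // in jmax jmin.
rewrite rhsE in smax smin.
have le0 f := @loadV_le0 _ _ _ hOmega _ hphi f i.
have ge0 f := @loadV_ge0 _ _ _ hOmega _ hphi f i.
split=> s0; split=> hf.
- by case: (smax (le0 _ irhs hf)) => /(_ (ltW s0)).
- by case: (smin (ge0 _ irhs hf)) => /(_ (ltW s0)).
- by case: (jmax (le0 _ iY hf)) => /(_ (ltW s0)).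
- by case: (jmin (ge0 _ iY hf)) => /(_ (ltW s0)).
- by case: (smax (le0 _ irhs hf)) => _ /(_ s0).
- by case: (smin (ge0 _ irhs hf)) => _ /(_ s0).
- by case: (jmax (le0 _ iY hf)) => _ /(_ s0).
- by case: (jmin (ge0 _ iY hf)) => _ /(_ s0).
Qed.
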